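(* For $(\varepsilon_1,\varepsilon_2,\varepsilon_3,\varepsilon_4)\in\{+,-\}^4$ let $\tau^{uw}_{\varepsilon_1,\varepsilon_2,\varepsilon_3,\varepsilon_4}$ be the transformation of the canonical variables $u_1,u_2,u_3,w_1,w_2,w_3$ induced by the monomial part $\tau_{\varepsilon_1,\varepsilon_2,\varepsilon_3,\varepsilon_4}$ of the cluster transformation (both defined in the context). A realization of $\tau^{uw}_{\varepsilon_1,\varepsilon_2,\varepsilon_3,\varepsilon_4}$ as an adjoint action of the form $$\tau^{uw}_{\varepsilon_1,\varepsilon_2,\varepsilon_3,\varepsilon_4}=\mathrm{Ad}\bigl(e^{\frac1{2\hbar}X}\,\rho\,e^{\frac1{2\hbar}\mathcal{L}}\bigr),$$ $$X=\sum_{i<j}(\alpha_{ij}u_iu_j+\beta_{ij}w_iw_j)+\sum_{i\ne j}\gamma_{ij}u_iw_j,\qquad \mathcal{L}=\sum_i(\delta_iu_i+\delta_i'w_i),\qquad \rho\in\mathcal{S}_3,$$ with $\alpha_{ij},\beta_{ij},\gamma_{ij},\delta_i,\delta'_i\in\mathbb{C}$, is possible for, and only for, the six cases $$(\varepsilon_1,\varepsilon_2,\varepsilon_3,\varepsilon_4)\in\{(-,-,-,-),\,(-,-,+,+),\,(-,+,-,+),\,(+,-,+,-),\,(+,+,-,-),\,(+,+,+,+)\}.$$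
   Context: **Quivers and quantum tori.** $q=e^\hbar$ is generic. A skew-symmetric integer matrix $B=(b_{ij})_{i,j\in I}$ (exchange matrix) defines the skew field $\mathcal{Y}(B)$ generated by $Y_i$ $(i\in I)$ with $Y_iY_j=q^{2b_{ij}}Y_jY_i$. Mutation $\mu_k$ of $B$: $b'_{ij}=-b_{ij}$ if $i=k$ or $j=k$, and $b'_{ij}=b_{ij}+\frac{|b_{ik}|b_{kj}+b_{ik}|b_{kj}|}{2}$ otherwise. For $\varepsilon\in\{+,-\}$ and $B'=\mu_k(B)$, the isomorphism $\tau_{k,\varepsilon}:\mathcal{Y}(B')\to\mathcal{Y}(B)$ is $Y'_k\mapsto Y_k^{-1}$ and $Y'_i\mapsto q^{-b_{ik}[\varepsilon b_{ik}]_+}Y_iY_k^{[\varepsilon b_{ik}]_+}$ for $i\neq k$, where $[a]_+=\max(0,a)$. Let $I=\{1,\dots,9\}$ and let $B=B^{(1)}$ be the skew-symmetric matrix with $b_{12}=b_{25}=b_{54}=b_{41}=1$, $b_{34}=b_{48}=b_{87}=b_{73}=1$, $b_{56}=b_{69}=b_{98}=b_{85}=1$, all entries not determined by these and skew-symmetry being $0$. Put $B^{(2)}=\mu_8(B^{(1)})$, $B^{(3)}=\mu_5(B^{(2)})$, $B^{(4)}=\mu_4(B^{(3)})$, $B^{(5)}=\mu_8(B^{(4)})$, and let $B'=B^{(6)}$ be $B^{(5)}$ with the indices $4$ and $5$ exchanged. Let $\sigma_{45}:\mathcal{Y}(B^{(6)})\to\mathcal{Y}(B^{(5)})$ be $Y^{(6)}_4\mapsto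 Y^{(5)}_5$, $Y^{(6)}_5\mapsto Y^{(5)}_4$, $Y^{(6)}_i\mapsto Y^{(5)}_i$ otherwise. The monomial part is $$\tau_{\varepsilon_1,\varepsilon_2,\varepsilon_3,\varepsilon_4}=\tau_{8,\varepsilon_1}\tau_{5,\varepsilon_2}\tau_{4,\varepsilon_3}\tau_{8,\varepsilon_4}\sigma_{45}:\mathcal{Y}(B')\to\mathcal{Y}(B),$$ where $\tau_{8,\varepsilon_1},\tau_{5,\varepsilon_2},\tau_{4,\varepsilon_3},\tau_{8,\varepsilon_4}$ are the isomorphisms for the successive mutations $B^{(1)}\to B^{(2)}\to B^{(3)}\to B^{(4)}\to B^{(5)}$. Generators of $\mathcal{Y}(B),\mathcal{Y}(B')$ are written $Y_r,Y'_r$. **Canonical variables.** Let $u_i,w_i$ $(i=1,2,3)$ satisfy $[u_i,w_j]=2\hbar\delta_{ij}$, $[u_i,u_j]=[w_i,w_j]=0$, and let $\lambda_1,\lambda_2,\lambda_3\in\mathbb{C}$ be parameters. Let $\mathcal{W}_3$ be the algebra generated by $e^{\pm u_i},e^{\pm w_i}$ and $\mathcal{A}_3$ its noncommutative fraction field. The morphism $\phi:\mathcal{Y}(B)\to\mathcal{A}_3$ is $Y_1=e^{-w_2-\lambda_2}$, $Y_2=e^{u_2+\lambda_2}$, $Y_3=e^{-w_1-\lambda_1}$, $Y_4=e^{u_1-u_2+\lambda_1}$, $Y_5=e^{w_2-w_3-\lambda_3}$, $Y_6=e^{u_3+\lambda_3}$, $Y_7=e^{-u_1}$, $Y_8=e^{w_1-u_3}$,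 $Y_9=e^{w_3}$, and the morphism $\phi:\mathcal{Y}(B')\to\mathcal{A}_3$ is $Y'_1=e^{-w_3-\lambda_3}$, $Y'_2=e^{u_1+\lambda_1}$, $Y'_3=e^{-u_3}$, $Y'_4=e^{u_2-u_1+\lambda_2}$, $Y'_5=e^{w_3-w_2-\lambda_2}$, $Y'_6=e^{w_1}$, $Y'_7=e^{-u_2}$, $Y'_8=e^{u_3-w_1-\lambda_1+\lambda_3}$, $Y'_9=e^{w_2}$. For every choice of signs, $\tau^{uw}_{\varepsilon_1,\varepsilon_2,\varepsilon_3,\varepsilon_4}$ is the map sending each $u_i,w_i$ to a linear combination of the $u_j,w_j,\lambda_j$ such that the transformation it induces on exponentials satisfies $\tau^{uw}_{\varepsilon_1,\varepsilon_2,\varepsilon_3,\varepsilon_4}\circ\phi=\phi\circ\tau_{\varepsilon_1,\varepsilon_2,\varepsilon_3,\varepsilon_4}$ on $\mathcal{Y}(B')$. **The group $\mathcal{S}_3$ and the adjoint action.** $\mathcal{S}_3$ (of order $4^3\cdot 3!=384$) is the group of automorphisms generated by the permutations of the indices $\{1,2,3\}$ of the canonical variables and by the transformations, for each single index $i$, $(u_i,w_i)\mapsto(u_i,w_i),\,(w_i,-u_i),\,(-w_i,u_i),\,(-u_i,-w_i)$; these preserve the canonical commutation relations and fix the parameters $\lambda_i$. The adjoint action is $\mathrm{Ad}(g)(x)=gxg^{-1}$, so that on the canonical variables $\mathrm{Ad}(e^{\frac1{2\hbar}X}\rho\,e^{\frac1{2\hbar}\mathcal{L}})$ is the composition $\exp\bigl(\tfrac1{2\hbar}[X,\cdot\,]\bigr)\circ\rho\circ\exp\bigl(\tfrac1{2\hbar}[\mathcal{L},\cdot\,]\bigr)$.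 *)

(* Defs.v *)
From HB Require Import structures.
From mathcomp Require Import all_boot all_order all_algebra all_fingroup finmap.
From mathcomp Require Import complex ring.
From mathcomp Require Import all_classical all_reals all_analysis.
(* monalg's notations clash with those of the analysis library. *)
From mathcomp Require Import -(notations) monalg.

Set Implicit Arguments.
Unset Strict Implicit.
Unset Printing Implicit Defensive.

Import Order.TTheory GRing.Theory Num.Theory.
Import numFieldNormedType.Exports.

Local Open Scope ring_scope.
Local Open Scope complex_scope.

Section ComplexExponential.
Variable R : realType.
Implicit Types z : R[i].

Definition cexp z : R[i] :=
  let: a +i* b := z in (expR a * cos b) +i* (expR a * sin b).

Lemma cexp0 : cexp 0 = 1.
Proof. by rewrite /cexp /= expR0 cos0 sin0 mulr1 mulr0. Qed.

Lemma cexpD z1 z2 : cexp (z1 + z2) = cexp z1 * cexp z2.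
Proof.
case: z1 z2 => [a b] [c d] /=; rewrite expRD cosD sinD.
by apply/eqP; rewrite eq_complex /= !mulrBr !mulrDr !mulrA;
  apply/andP; split; apply/eqP; rewrite ![_ * _ * expR c]mulrAC // addrC.
Qed.

Lemma cexp_neq0 z : cexp z != 0.
Proof.
apply/eqP => z0; have := cexpD z (- z).
by rewrite z0 mul0r subrr cexp0 => /eqP; rewrite oner_eq0.
Qed.

End ComplexExponential.

Section QuantumTorus.
Variable R : realType.
Local Notation C := R[i].

Definition bform n (B : 'M[int]_n) (a b : 'rV[int]_n) : int :=
  (a *m B *m b^T) 0 0.

Lemma bformDl n (B : 'M[int]_n) a b c :
  bform B (a + b) c = bform B a c + bform B b c.
Proof. by rewrite /bform !mulmxDl mxE. Qed.

Lemma bformDr n (B : 'M[int]_n) a b c :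
  bform B a (b + c) = bform B a b + bform B a c.
Proof. by rewrite /bform linearD /= mulmxDr mxE. Qed.

Lemma bform0l n (B : 'M[int]_n) a : bform B 0 a = 0.
Proof. by rewrite /bform !mul0mx mxE. Qed.

Lemma bform0r n (B : 'M[int]_n) a : bform B a 0 = 0.
Proof. by rewrite /bform linear0 mulmx0 mxE. Qed.

Lemma malgZU (K : choiceType) (x y : C) (a : K) :
  x *: (mkmalgU a y : malg K C) = mkmalgU a (x * y).
Proof. by apply/malgP=> b; rewrite mcoeffZ !mcoeffU mulrnAr. Qed.

(* The quantum torus of B at q = e^hbar: the C-algebra with basis the
   Weyl-ordered monomials Y^a (a in Z^n), and Y^a Y^b = q^(B(a,b)) Y^(a+b).
   For B skew-symmetric this is the algebra generated by Y_i^(+-1) subject to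
   Y_i Y_j = q^(2 b_ij) Y_j Y_i. *)
Definition qtorus (hbar : C) n (B : 'M[int]_n) : Type := malg 'rV[int]_n C.

HB.instance Definition _ hbar n (B : 'M[int]_n) :=
  GRing.Zmodule.on (qtorus hbar B).

Section Structure.
Variables (hbar : C) (n : nat) (B : 'M[int]_n).
Local Notation q := (cexp hbar).
Local Notation T := (qtorus hbar B).
Implicit Types (f g : T) (a b : 'rV[int]_n) (x y : C).

Fact qscale_key : unit. Proof. by []. Qed.

Definition qscale : C -> T -> T :=
  locked_with qscale_key (fun x f => x *: (f : malg 'rV[int]_n C)).

Lemma qscaleE x f : qscale x f = x *: (f : malg 'rV[int]_n C).
Proof. by rewrite [qscale]unlock. Qed.

Lemma qscaleA x y f : qscale x (qscale y f) = qscale (x * y) f.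
Proof. by rewrite !qscaleE scalerA. Qed.

Lemma qscale1 : left_id 1 qscale.
Proof. by move=> f; rewrite qscaleE scale1r. Qed.

Lemma qscaleDr : right_distributive qscale +%R.
Proof. by move=> x f g; rewrite !qscaleE scalerDr. Qed.

Lemma qscaleDl f : {morph qscale^~ f : x y / x + y}.
Proof. by move=> x y; rewrite !qscaleE scalerDl. Qed.

HB.instance Definition _ := GRing.Zmodule_isLmodule.Build C T
  qscaleA qscale1 qscaleDr qscaleDl.

Fact qterm_key : unit. Proof. by []. Qed.

Definition qterm : 'rV[int]_n -> C -> T :=
  locked_with qterm_key (fun a x => mkmalgU a x).

Lemma qtermE a x : qterm a x = mkmalgU a x.
Proof. by rewrite [qterm]unlock. Qed.

Definition qmono a : T := qterm a 1.

Fact qmul_key : unit. Proof. by []. Qed.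

Definition qmul : T -> T -> T := locked_with qmul_key (fun f g =>
  \sum_(a <- msupp f) \sum_(b <- msupp g)
     qterm (a + b) (mcoeff a f * mcoeff b g * q ^ bform B a b)).

Lemma qmulE f g : qmul f g =
  \sum_(a <- msupp f) \sum_(b <- msupp g)
     qterm (a + b) (mcoeff a f * mcoeff b g * q ^ bform B a b).
Proof. by rewrite [qmul]unlock. Qed.

Lemma qpowD (m p : int) : q ^ (m + p) = q ^ m * q ^ p.
Proof. exact: expfzDr (cexp_neq0 _). Qed.

Lemma qmulw (d1 d2 : {fset 'rV[int]_n}) f g :
  (msupp f `<=` d1)%fset -> (msupp g `<=` d2)%fset ->
  qmul f g = \sum_(a <- d1) \sum_(b <- d2)
     qterm (a + b) (mcoeff a f * mcoeff b g * q ^ bform B a b).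
Proof.
move=> le1 le2; rewrite qmulE (big_fset_incl _ le1) /=.
  apply/eq_bigr=> a _; apply/big_fset_incl => // b _ /mcoeff_outdom ->.
  by rewrite mulr0 mul0r qtermE monalgU0.
move=> a _ /mcoeff_outdom fa.
by rewrite big1 // => b _; rewrite fa !mul0r qtermE monalgU0.
Qed.

Lemma qmulUU a b x y :
  qmul (qterm a x) (qterm b y) = qterm (a + b) (x * y * q ^ bform B a b).
Proof. by rewrite !qtermE (qmulw msuppU_le msuppU_le) !big_seq_fset1 !mcoeffUU qtermE. Qed.

Lemma qmulDl : left_distributive qmul +%R.
Proof.
move=> f1 f2 g.
rewrite [in RHS](qmulw (fsubsetUl _ (msupp f2)) (fsubset_refl _)).
rewrite [in RHS](qmulw (fsubsetUr (msupp f1) _) (fsubset_refl _)).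
rewrite (qmulw (msuppD_le _ _) (fsubset_refl _)) -big_split /=.
apply/eq_bigr=> a _; rewrite -big_split /=; apply/eq_bigr=> b _.
by rewrite mcoeffD !mulrDl !qtermE monalgUD.
Qed.

Lemma qmulDr : right_distributive qmul +%R.
Proof.
move=> g f1 f2.
rewrite [in RHS](qmulw (fsubset_refl _) (fsubsetUl _ (msupp f2))).
rewrite [in RHS](qmulw (fsubset_refl _) (fsubsetUr (msupp f1) _)).
rewrite (qmulw (fsubset_refl _) (msuppD_le _ _)) -big_split /=.
apply/eq_bigr=> a _; rewrite -big_split /=; apply/eq_bigr=> b _.
by rewrite mcoeffD mulrDr !mulrDl !qtermE monalgUD.
Qed.

Lemma qmul0l g : qmul 0 g = 0.
Proof. by rewrite qmulE msupp0 big_seq_fset0. Qed.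

Lemma qmul0r f : qmul f 0 = 0.
Proof. by rewrite qmulE msupp0; apply: big1 => a _; rewrite big_seq_fset0. Qed.

Lemma qmul_suml I (r : seq I) (F : I -> T) g :
  qmul (\sum_(i <- r) F i) g = \sum_(i <- r) qmul (F i) g.
Proof.
exact: (big_morph (qmul^~ g) (fun _ _ => qmulDl _ _ _) (qmul0l g)).
Qed.

Lemma qmul_sumr I (r : seq I) (F : I -> T) f :
  qmul f (\sum_(i <- r) F i) = \sum_(i <- r) qmul f (F i).
Proof.
exact: (big_morph (qmul f) (fun _ _ => qmulDr _ _ _) (qmul0r f)).
Qed.

Lemma qtorus_ind (P : T -> Prop) :
  P 0 -> (forall f g, P f -> P g -> P (f + g)) ->
  (forall a x, P (qterm a x)) -> forall f, P f.
Proof.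
by move=> P0 PD PU f; rewrite [f]monalgE; elim/big_ind: _ => //= a _; rewrite -qtermE; apply: PU.
Qed.

Lemma qmulA : associative qmul.
Proof.
move=> f g h; elim/qtorus_ind: f => [|f1 f2 E1 E2|a x].
- by rewrite !qmul0l.
- by rewrite (qmulDl f1 f2 g) (qmulDl f1 f2 (qmul g h)) E1 E2 -qmulDl.
elim/qtorus_ind: g => [|g1 g2 E1 E2|b y].
- by rewrite (qmul0r (qterm a x)) (qmul0l h) (qmul0r (qterm a x)).
- by rewrite (qmulDl g1 g2 h) (qmulDr (qterm a x) g1 g2) qmulDr E1 E2 -qmulDl.
elim/qtorus_ind: h => [|h1 h2 E1 E2|c z].
- by rewrite (qmul0r (qterm b y)) !qmul0r.
- by rewrite (qmulDr (qterm b y) h1 h2) qmulDr E1 E2 -qmulDr.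
rewrite !qmulUU addrA; congr qterm; rewrite bformDl bformDr !qpowD.
by move: (q ^ bform B a b) (q ^ bform B a c) (q ^ bform B b c) => r s t; ring.
Qed.

Lemma qmul1l : left_id (qmono 0) qmul.
Proof.
move=> f; elim/qtorus_ind: f => [|f1 f2 E1 E2|a x].
- exact: qmul0r.
- by rewrite qmulDr E1 E2.
by rewrite qmulUU add0r bform0l mul1r expr0z mulr1.
Qed.

Lemma qmul1r : right_id (qmono 0) qmul.
Proof.
move=> f; elim/qtorus_ind: f => [|f1 f2 E1 E2|a x].
- exact: qmul0l.
- by rewrite qmulDl E1 E2.
by rewrite qmulUU addr0 bform0r !mulr1.
Qed.

Lemma qone_neq0 : qmono 0 != 0.
Proof. by rewrite /qmono qtermE; apply/eqP => /malgP/(_ 0)/eqP; rewrite mcoeffUU mcoeff0 oner_eq0. Qed.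

HB.instance Definition _ := GRing.Zmodule_isNzRing.Build T
  qmulA qmul1l qmul1r qmulDl qmulDr qone_neq0.

Lemma qtermM a b x y :
  qterm a x * qterm b y = qterm (a + b) (x * y * q ^ bform B a b).
Proof. exact: qmulUU. Qed.

Lemma qtermZ (x y : C) a : x *: qterm a y = qterm a (x * y) :> T.
Proof. rewrite !qtermE [LHS]qscaleE; exact: malgZU. Qed.

Lemma qscaleAl (x : C) (f g : T) : x *: (f * g) = x *: f * g.
Proof.
elim/qtorus_ind: f => [|f1 f2 E1 E2|a y].
- by rewrite scaler0 mul0r scaler0.
- by rewrite mulrDl !scalerDr mulrDl E1 E2.
elim/qtorus_ind: g => [|g1 g2 E1 E2|b z].
- by rewrite !mulr0 scaler0.
- by rewrite !mulrDr scalerDr E1 E2.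
by rewrite qtermZ !qtermM qtermZ !mulrA.
Qed.

HB.instance Definition _ := GRing.Lmodule_isLalgebra.Build C T qscaleAl.

Lemma qscaleAr (x : C) (f g : T) : x *: (f * g) = f * (x *: g).
Proof.
elim/qtorus_ind: f => [|f1 f2 E1 E2|a y].
- by rewrite !mul0r scaler0.
- by rewrite !mulrDl scalerDr E1 E2.
elim/qtorus_ind: g => [|g1 g2 E1 E2|b z].
- by rewrite mulr0 scaler0 mulr0.
- by rewrite mulrDr !scalerDr mulrDr E1 E2.
by rewrite qtermZ !qtermM qtermZ !mulrA [x * y]mulrC.
Qed.

HB.instance Definition _ := GRing.Lalgebra_isAlgebra.Build C T qscaleAr.

Definition qunit : pred T := fun f => `[< exists g, g * f = 1 /\ f * g = 1 >].

Definition qinv f : T :=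
  if pselect (exists g, g * f = 1 /\ f * g = 1) is left h
  then projT1 (cid h) else f.

Lemma qmulVr : {in qunit, left_inverse 1 qinv *%R}.
Proof.
move=> f /asboolP hf; rewrite /qinv; case: pselect => // h.
by case: (cid h) => g [].
Qed.

Lemma qmulrV : {in qunit, right_inverse 1 qinv *%R}.
Proof.
move=> f /asboolP hf; rewrite /qinv; case: pselect => // h.
by case: (cid h) => g [].
Qed.

Lemma qunitP f g : g * f = 1 /\ f * g = 1 -> f \in qunit.
Proof. by move=> h; apply/asboolP; exists g. Qed.

Lemma qinv_out : {in [predC qunit], qinv =1 id}.
Proof.
move=> f /negP hf; rewrite /qinv; case: pselect => // h.
by case: hf; apply/asboolP.
Qed.

HB.instance Definition _ := GRing.NzRing_hasMulInverse.Build T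
  qmulVr qmulrV qunitP qinv_out.

Lemma qmonoM a b : qmono a * qmono b = q ^ bform B a b *: qmono (a + b).
Proof. by rewrite qtermZ qtermM !mul1r mulr1. Qed.

Definition qgen (i : 'I_n) : T := qmono (delta_mx 0 i).

Lemma bform_delta i j : bform B (delta_mx 0 i) (delta_mx 0 j) = B i j.
Proof. by rewrite /bform -rowE trmx_delta -colE !mxE. Qed.

Lemma qgen_comm i j : (forall k l, B k l = - B l k) ->
  qgen i * qgen j = q ^ (B i j *+ 2) *: (qgen j * qgen i).
Proof.
move=> skewB; rewrite !qmonoM scalerA !bform_delta -qpowD.
by rewrite (skewB j i) mulr2n addrK [_ + delta_mx 0 i]addrC.
Qed.

End Structure.
End QuantumTorus.

Arguments qmono {R hbar n B} a.
Arguments qgen {R hbar n B} i.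

(* 1-based names of the elements of 'I_9 and 'I_3. *)
Notation ix r := (@Ordinal 9 r.-1 isT) (only parsing).
Notation jx r := (@Ordinal 3 r.-1 isT) (only parsing).

Section ExchangeMatrices.

Definition mutation n (k : 'I_n) (B : 'M[int]_n) : 'M[int]_n :=
  \matrix_(i, j)
    if (i == k) || (j == k) then - B i j
    else B i j + ((`|B i k| * B k j + B i k * `|B k j|) %/ 2)%Z.

Definition arrows : seq (nat * nat) :=
  [:: (1, 2); (2, 5); (5, 4); (4, 1);
      (3, 4); (4, 8); (8, 7); (7, 3);
      (5, 6); (6, 9); (9, 8); (8, 5)]%N.

Definition B1 : 'M[int]_9 :=
  \matrix_(i, j) (((i.+1, j.+1) \in arrows)%:Z - ((j.+1, i.+1) \in arrows)%:Z).
Definition B2 := mutation (ix 8) B1.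
Definition B3 := mutation (ix 5) B2.
Definition B4 := mutation (ix 4) B3.
Definition B5 := mutation (ix 8) B4.
Definition B6 := xcol (ix 4) (ix 5) (xrow (ix 4) (ix 5) B5).

End ExchangeMatrices.

Section MonomialPart.
Variables (R : realType) (hbar : R[i]).
Local Notation q := (cexp hbar).

(* Signs are booleans: true is +, false is -. *)
Definition sign_int (e : bool) : int := if e then 1 else -1.

Definition is_tau n (k : 'I_n) (B : 'M[int]_n) (e : bool)
    (f : qtorus hbar (mutation k B) -> qtorus hbar B) : Prop :=
  f (qgen k) = (qgen k)^-1 /\
  forall i, i != k ->
    let p := Num.max 0 (sign_int e * B i k) in
    f (qgen i) = q ^ (- B i k * p) *: (qgen i * qgen k ^ p).

Arguments is_tau {n} k B e f.

Definition is_sigma45 (f : qtorus hbar B6 -> qtorus hbar B5) : Prop :=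
  forall i, f (qgen i) = qgen (tperm (ix 4) (ix 5) i).

Definition is_monomial_part (e1 e2 e3 e4 : bool)
    (tau : qtorus hbar B6 -> qtorus hbar B1) : Prop :=
  exists (t1 : {lrmorphism qtorus hbar B2 -> qtorus hbar B1})
         (t2 : {lrmorphism qtorus hbar B3 -> qtorus hbar B2})
         (t3 : {lrmorphism qtorus hbar B4 -> qtorus hbar B3})
         (t4 : {lrmorphism qtorus hbar B5 -> qtorus hbar B4})
         (sigma : {lrmorphism qtorus hbar B6 -> qtorus hbar B5}),
    [/\ is_tau (ix 8) B1 e1 t1, is_tau (ix 5) B2 e2 t2,
        is_tau (ix 4) B3 e3 t3 & is_tau (ix 8) B4 e4 t4] /\
    is_sigma45 sigma /\
    forall y, tau y = t1 (t2 (t3 (t4 (sigma y)))).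

End MonomialPart.

Arguments is_tau {R hbar n} k B e f.

(* Formal integer linear combinations of u_j, w_j and lambda_j (j = 1, 2, 3). *)
Notation linform := ('rV[int]_3 * 'rV[int]_3 * 'rV[int]_3)%type.

Section CanonicalVariables.
Variables (R : realType) (hbar : R[i]) (lambda : 'I_3 -> R[i]).
Local Notation C := R[i].

Definition fu (j : 'I_3) : linform := (delta_mx 0 j, 0, 0).
Definition fw (j : 'I_3) : linform := (0, delta_mx 0 j, 0).
Definition fl (j : 'I_3) : linform := (0, 0, delta_mx 0 j).

Definition lambda_part (l : linform) : C := \sum_j (l.2 0 j)%:~R * lambda j.

(* [u_i, w_j] = 2 hbar delta_ij gives
   e^a e^b = e^([a, b] / 2) e^(a + b) = q^(Omega(a, b)) e^(a + b). *)
Definition Omega : 'M[int]_(3 + 3) := block_mx 0 1%:M (- 1%:M) 0.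
Definition W3 := qtorus hbar Omega.
HB.instance Definition _ := GRing.UnitAlgebra.on W3.

(* e^l, the lambda_j being complex numbers *)
Definition expform (l : linform) : W3 :=
  cexp (lambda_part l) *: qmono (row_mx l.1.1 l.1.2).

Local Notation u1 := (fu (jx 1)). Local Notation w1 := (fw (jx 1)).
Local Notation u2 := (fu (jx 2)). Local Notation w2 := (fw (jx 2)).
Local Notation u3 := (fu (jx 3)). Local Notation w3 := (fw (jx 3)).
Local Notation l1 := (fl (jx 1)).
Local Notation l2 := (fl (jx 2)).
Local Notation l3 := (fl (jx 3)).

Definition phi_form : seq linform :=
  [:: - w2 - l2; u2 + l2; - w1 - l1; u1 - u2 + l1; w2 - w3 - l3;
      u3 + l3; - u1; w1 - u3; w3].

Definition phi'_form : seq linform :=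
  [:: - w3 - l3; u1 + l1; - u3; u2 - u1 + l2; w3 - w2 - l2;
      w1; - u2; u3 - w1 - l1 + l3; w2].

(* phi and phi' are morphisms of quantum tori; they do not extend to the skew
   fields of fractions, as both send Y^(1,...,1) to 1. *)
Definition is_phi (f : qtorus hbar B1 -> W3) : Prop :=
  forall r : 'I_9, f (qgen r) = expform (nth 0 phi_form r).

Definition is_phi' (f : qtorus hbar B6 -> W3) : Prop :=
  forall r : 'I_9, f (qgen r) = expform (nth 0 phi'_form r).

(* A transformation of the canonical variables: the images of the u_i and of
   the w_i.  The coefficients are integers: e^(image) must lie in W3, and the
   lambda_j are independent parameters. *)
Record uwmap := UWMap { im_u : 'I_3 -> linform; im_w : 'I_3 -> linform }.

Definition induced_on_exp (T : uwmap) (f : W3 -> W3) : Prop :=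
  forall i, f (expform (fu i)) = expform (im_u T i) /\
            f (expform (fw i)) = expform (im_w T i).

Definition is_tau_uw (e1 e2 e3 e4 : bool) (T : uwmap) : Prop :=
  exists (tau : {lrmorphism qtorus hbar B6 -> qtorus hbar B1})
         (phi : {lrmorphism qtorus hbar B1 -> W3})
         (phi' : {lrmorphism qtorus hbar B6 -> W3})
         (hatT : {lrmorphism W3 -> W3}),
    [/\ is_monomial_part e1 e2 e3 e4 tau, is_phi phi, is_phi' phi',
        induced_on_exp T hatT & forall y, hatT (phi' y) = phi (tau y)].

End CanonicalVariables.

Section AdjointAction.
Variables (R : realType) (hbar : R[i]) (lambda : 'I_3 -> R[i]).
Local Notation C := R[i].
Variables (A : algType C) (u w : 'I_3 -> A).

Local Notation "[[ x , y ]]" := (x * y - y * x).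

Definition canonical_commutation : Prop :=
  forall i j, [/\ [[u i, w j]] = (2 * hbar * (i == j)%:R)%:A,
                  [[u i, u j]] = 0 & [[w i, w j]] = 0].

(* Coordinates on the space spanned by the u_i, the w_i and the constants. *)
Local Notation V := 'rV[C]_(3 + 3 + 1).

Definition pos_u (i : 'I_3) : 'I_(3 + 3 + 1) := lshift 1 (lshift 3 i).
Definition pos_w (i : 'I_3) : 'I_(3 + 3 + 1) := lshift 1 (rshift 3 i).
Definition pos_c : 'I_(3 + 3 + 1) := rshift (3 + 3) ord0.

Definition vu (i : 'I_3) : V := delta_mx 0 (pos_u i).
Definition vw (i : 'I_3) : V := delta_mx 0 (pos_w i).
Definition vc : V := delta_mx 0 pos_c.

Definition affine (v : V) : A :=
  \sum_i (v 0 (pos_u i) *: u i + v 0 (pos_w i) *: w i) + (v 0 pos_c)%:A.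

Definition eval_form (l : linform) : V :=
  \sum_i ((l.1.1 0 i)%:~R *: vu i + (l.1.2 0 i)%:~R *: vw i) +
  lambda_part lambda l *: vc.

(* The topology of C is attached to its numClosedFieldType structure. *)
Definition Cfield : numClosedFieldType := R[i].

(* y = exp ((1 / (2 hbar)) [X, .]) x: the partial sums of the exponential
   series at x stay in the span of the u_i, the w_i and 1, and converge there
   to y. *)
Definition ad_exp (X x y : A) : Prop :=
  exists (s : nat -> 'rV[Cfield]_(3 + 3 + 1)) (l : 'rV[Cfield]_(3 + 3 + 1)),
    [/\ forall n, affine (s n) =
          \sum_(k < n) (k`!%:R)^-1 *:
             iter k (fun z => (2 * hbar)^-1 *: [[X, z]]) x,
        (s @ \oo --> l)%classic & y = affine l].

Definition quadraticX (alpha beta gamma : 'I_3 -> 'I_3 -> C) : A :=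
  \sum_(i < 3) \sum_(j < 3 | (i < j)%N)
     (alpha i j *: (u i * u j) + beta i j *: (w i * w j)) +
  \sum_(i < 3) \sum_(j < 3 | i != j) gamma i j *: (u i * w j).

Definition linearL (delta delta' : 'I_3 -> C) : A :=
  \sum_i (delta i *: u i + delta' i *: w i).

(* The linear map fixing the constants with u_i |-> a i and w_i |-> b i. *)
Definition vsubst (a b : 'I_3 -> V) (v : V) : V :=
  \sum_i (v 0 (pos_u i) *: a i + v 0 (pos_w i) *: b i) + v 0 pos_c *: vc.

Definition single_turn (i : 'I_3) (p : V * V) : V -> V :=
  vsubst (fun j => if j == i then p.1 else vu j)
         (fun j => if j == i then p.2 else vw j).

Inductive in_S3 : (V -> V) -> Prop :=
| S3_perm (s : 'S_3) :
    in_S3 (vsubst (fun i => vu (s i)) (fun i => vw (s i)))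
| S3_turn (i : 'I_3) (p : V * V) :
    p \in [:: (vu i, vw i); (vw i, - vu i); (- vw i, vu i); (- vu i, - vw i)] ->
    in_S3 (single_turn i p)
| S3_comp f g : in_S3 f -> in_S3 g -> in_S3 (f \o g).

(* x |-> y under
   exp ((1/(2 hbar)) [X, .]) o rho o exp ((1/(2 hbar)) [L, .]) *)
Definition Ad_maps (X : A) (rho : V -> V) (L x y : A) : Prop :=
  exists v : V, ad_exp L x (affine v) /\ ad_exp X (affine (rho v)) y.

Definition adjoint_realizable (T : uwmap) : Prop :=
  exists (alpha beta gamma : 'I_3 -> 'I_3 -> C) (delta delta' : 'I_3 -> C)
         (rho : V -> V),
    in_S3 rho /\
    forall i,
      Ad_maps (quadraticX alpha beta gamma) rho (linearL delta delta')
        (u i) (affine (eval_form (im_u T i))) /\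
      Ad_maps (quadraticX alpha beta gamma) rho (linearL delta delta')
        (w i) (affine (eval_form (im_w T i))).

End AdjointAction.

(* Main.v *)
(* Only linear parts matter, since L produces arbitrary constants. Acting on row
   vectors in the basis u_1, u_2, u_3, w_1, w_2, w_3, tau^uw becomes an integer
   symplectic matrix M, rho a signed permutation matrix P, and (1/(2 hbar)) [X, .]
   a matrix N whose four 3 x 3 blocks have zero diagonal; a realization amounts to
   M = P exp(N). For the six good sign choices, some P makes P^-1 M - 1 a matrix
   of this shape with square zero, and N = P^-1 M - 1 works. In the other ten
   cases N would commute with E = P^-1 M = exp(N), a linear system for the twelve
   coefficients of X. For each of the 384 matrices P this system forces v N = 0
   for some integer vector v with v E <> v, which is absurd. The only exceptions
   are one P for each of the signs (-,+,-,-) and (+,+,-,+): there the same idea is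
   applied to vectors with v N^2 = 0, for which v E = v + v N. The systems are
   solved by Gaussian elimination over Z. *)

Require Import Defs.
From Stdlib Require Import BinInt.
From mathcomp Require Import all_boot all_order all_algebra all_fingroup complex.
From mathcomp Require Import ring all_classical all_reals all_analysis.
From mathcomp Require Import ssrZ zify.

Set Implicit Arguments.
Unset Strict Implicit.
Unset Printing Implicit Defensive.

Import GRing.Theory Num.Theory.
Import numFieldNormedType.Exports.
Local Open Scope ring_scope.
Local Open Scope complex_scope.

(** * Linear systems for matrices commuting with an exponential *)

Definition table T := seq (seq T).
Definition tabulate T m n (f : nat -> nat -> T) : table T :=
  mkseq (fun i => mkseq (f i) n) m.
Definition entry T (d : T) (A : table T) i j := nth d (nth [::] A i) j.

Lemma entry_tabulate T (d : T) m n f (i : 'I_m) (j : 'I_n) :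
  entry d (tabulate m n f) i j = f i j.
Proof. by rewrite /entry /tabulate !nth_mkseq. Qed.

(** Everything evaluated for each of the matrices P works on lists of binary integers, which compute
    by conversion; all matrices here are 6 x 6. *)
Definition zdot (f g : nat -> Z) : Z :=
  foldr (fun k acc => Z.add (Z.mul (f k) (g k)) acc) Z0 (iota 0 6).
Definition zmul (A B : table Z) : table Z :=
  tabulate 6 6 (fun i j => zdot (entry Z0 A i) (fun k => entry Z0 B k j)).
Definition ztr (A : table Z) : table Z :=
  tabulate 6 6 (fun i j => entry Z0 A j i).
Definition zone : table Z :=
  tabulate 6 6 (fun i j => if i == j then Zpos xH else Z0).
Definition zeq (A B : table Z) : bool :=
  all (fun i => all (fun j => Z.eqb (entry Z0 A i j) (entry Z0 B i j))
    (iota 0 6)) (iota 0 6).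
(** A symplectic matrix with blocks A, B, C, D has the inverse with blocks D^T, -B^T, -C^T, A^T.
    That this inverts the matrices at hand is checked by evaluation in [never_exp]. *)
Definition zsympl_inv (A : table Z) : table Z := tabulate 6 6 (fun i j =>
  let e := entry Z0 A ((j + 3) %% 6)%N ((i + 3) %% 6)%N in
  if (i < 3)%N == (j < 3)%N then e else Z.opp e).

(* The coefficients of a linear form in the unknowns x_0, x_1, ... *)
Definition form := seq Z.

Fixpoint lincomb (a : Z) (r : form) (b : Z) (s : form) : form :=
  match r, s with
  | x :: r', y :: s' => Z.add (Z.mul a x) (Z.mul b y) :: lincomb a r' b s'
  | [::], _ => map (Z.mul b) s
  | _, [::] => map (Z.mul a) r
  end.

Definition add_scaled (c : Z) (r acc : form) : form :=
  if c is Z0 then acc else lincomb (Zpos xH) acc c r.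
Definition fdot (c : nat -> Z) (f : nat -> form) : form :=
  foldr (fun k acc => add_scaled (c k) (f k) acc) [::] (iota 0 6).
Definition zfmul (A : table Z) (Y : table form) : table form :=
  tabulate 6 6 (fun i j => fdot (entry Z0 A i) (fun k => entry [::] Y k j)).
Definition fzmul (Y : table form) (A : table Z) : table form :=
  tabulate 6 6 (fun i j => fdot (fun k => entry Z0 A k j) (entry [::] Y i)).

Definition fzero (r : form) : bool :=
  all (fun c => if c is Z0 then true else false) r.

Fixpoint lead (r : form) : option (nat * Z) :=
  match r with
  | [::] => None
  | Z0 :: r' => if lead r' is Some (l, p) then Some (l.+1, p) else None
  | p :: _ => Some (0%N, p)
  end.

(** An entry [(l, p, s)] is an equation s = 0 with pivot p at position l. *)
Definition echelon := seq (nat * Z * form).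

(** Elimination without division: p r - c s no longer contains the unknown l. One pass in the order
    of insertion suffices, since each stored equation was itself reduced by the earlier ones. *)
Fixpoint reduce (b : echelon) (r : form) : form :=
  if b is ((l, p), s) :: b' then
    match nth Z0 r l with
    | Z0 => reduce b' r
    | c => reduce b' (lincomb p r (Z.opp c) s)
    end
  else r.

(** Twelve independent equations in the twelve unknowns already force N = 0, so the elimination
    stops there. *)
Definition insert (b : echelon) (r : form) : echelon :=
  if (12 <= size b)%N then b else
  let r' := reduce b r in
  if lead r' is Some lp then rcons b (lp, r') else b.

Definition vanishes (b : echelon) (r : form) := fzero (reduce b r).

(* The unknowns x_0, ..., x_11 are in turn alpha_12, alpha_13, alpha_23, beta_12,
   beta_13, beta_23, gamma_12, gamma_13, gamma_21, gamma_23, gamma_31, gamma_32. *)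
Definition unknown k (c : Z) : form := rcons (nseq k Z0) c.
(** The pairs 01, 02, 12 have the sums 1, 2, 3. In [gamma_index] the two indices other than i are
    numbered 0 and 1. *)
Definition sym_index i j : nat := (i + j).-1.
Definition gamma_index i j : nat :=
  (6 + i.*2 + (if (j < i)%N then j else j.-1))%N.

(** Row i is the image of the i-th of u_1, ..., w_3 under (1/(2 hbar)) [X, .]. For a <> b, u_a u_b
    sends w_b to u_a, w_a w_b sends u_b to -w_a, and u_a w_b sends u_b to -u_a and w_a to w_b. *)
Definition ad_form (i j : nat) : form :=
  let i' := (i %% 3)%N in let j' := (j %% 3)%N in
  if i' == j' then [::] else
  match (i < 3)%N, (j < 3)%N with
  | true, true => unknown (gamma_index j' i') (Zneg xH)
  | true, false => unknown (3 + sym_index i' j') (Zneg xH)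
  | false, true => unknown (sym_index i' j') (Zpos xH)
  | false, false => unknown (gamma_index i' j') (Zpos xH)
  end.
Definition ad_table := tabulate 6 6 ad_form.

Definition row_ad (v : seq Z) j : form :=
  fdot (nth Z0 v) (fun k => entry [::] ad_table k j).
Definition zrow_dot (v : seq Z) (E : table Z) j : Z :=
  zdot (nth Z0 v) (fun k => entry Z0 E k j).

(* A vector v, and pairs (k1, k2) such that v N should be the combination of the
   vectors k2, whose coefficients are the entries k1 of v N, and k2 N = 0. *)
Definition candidate := (seq Z * seq (nat * seq Z))%type.

Definition killed_twice (b : echelon) (c : candidate) : bool :=
  let: (v, ks) := c in
  all (fun k => all (fun j => vanishes b (row_ad k.2 j)) (iota 0 6)) ks &&
  all (fun j => vanishes b
    (foldr (fun k acc => add_scaled (Z.opp (nth Z0 k.2 j)) (row_ad v k.1) acc)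
       (row_ad v j) ks)) (iota 0 6).

(** If v N^2 = 0 then v E = v + v N, which fails at a coordinate where v N vanishes while v E
    differs from v. *)
Definition contradicts (b : echelon) (E : table Z) (c : candidate) : bool :=
  has (fun j => ~~ Z.eqb (zrow_dot c.1 E j) (nth Z0 c.1 j)
                && vanishes b (row_ad c.1 j)) (iota 0 6) && killed_twice b c.

(* If v N^2 = 0 and v E = v then v N = 0, which provides new equations. *)
Definition refine (E : table Z) (b : echelon) (c : candidate) : echelon :=
  if all (fun j => Z.eqb (zrow_dot c.1 E j) (nth Z0 c.1 j)) (iota 0 6)
     && killed_twice b c
  then foldl insert b [seq row_ad c.1 j | j <- iota 0 6] else b.

Definition difference (U Y : table form) (ij : nat * nat) : form :=
  lincomb (Zpos xH) (entry [::] U ij.1 ij.2) (Zneg xH) (entry [::] Y ij.1 ij.2).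
(* The diagonals of the 3 x 3 blocks come first: they give the shortest forms,
   which makes the elimination much faster. *)
Definition differences (U Y : table form) : seq form :=
  [seq difference U Y ij | ij <-
    [seq (i, (i + j) %% 6)%N | j <- [:: 0; 3; 1; 2; 4; 5]%N, i <- iota 0 6]].

(** The linear system equates U = P N P^T with M N M^-1, the second member of [MY]. Either some
    vector of [cs] contradicts it, or one of [cs'] does after [rs] has supplied new equations. *)
Definition not_exp (cs rs cs' : seq candidate) (Pt : table Z) (U : table form)
    (MY : table Z * table form) : bool :=
  let b := foldl insert [::] (differences U MY.2) in
  let E := zmul Pt MY.1 in
  has (contradicts b E) cs ||
  (let b' := foldl (refine E) b rs in has (contradicts b' E) cs').

(* The permutation pi of the indices, index i being also turned by the k_i-th
   power of (u, w) |-> (w, -u). *)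
Definition turn_table (pi k : seq nat) : table Z := tabulate 6 6 (fun i j =>
  let i' := (i %% 3)%N in
  let a := ((nth 0 k i' + i %/ 3) %% 4)%N in
  if j == (nth 0 pi i' + 3 * odd a)%N
  then (if (1 < a)%N then Zneg xH else Zpos xH) else Z0).
Definition perms3 : seq (seq nat) :=
  [:: [:: 0; 1; 2]; [:: 0; 2; 1]; [:: 1; 0; 2]; [:: 1; 2; 0]; [:: 2; 0; 1];
      [:: 2; 1; 0]]%N.
Definition turns : seq (seq nat) :=
  [seq a :: bc | a <- iota 0 4, bc <- [seq [:: b; c] | b <- iota 0 4, c <- iota 0 4]].

(* M N M^-1, which has to be P N P^-1 when N commutes with P^-1 M. *)
Definition conj_table (M : table Z) : table form :=
  fzmul (zfmul M ad_table) (zsympl_inv M).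

(* U = P N P^T does not depend on M: it is shared between all M. *)
Definition never_exp (I : Type) (cs rs cs' : seq candidate) (M : I -> table Z)
    (r : seq I) : bool :=
  all (fun i => zeq (zmul (M i) (zsympl_inv (M i))) zone) r &&
  (let MYs := [seq (M i, conj_table (M i)) | i <- r] in
   all (fun pi => all (fun k =>
     let P := turn_table pi k in let Pt := ztr P in
     let U := fzmul (zfmul P ad_table) Pt in
     zeq (zmul Pt P) zone && all (not_exp cs rs cs' Pt U) MYs) turns) perms3).

Definition zvec : seq int -> seq Z := map Z_of_int.
(* Vectors found by computing, for all M and P, the common kernel of the solutions
   N of the linear system. *)
Definition candidates : seq candidate :=
  [seq (zvec v, [::]) | v <-
    [:: [:: 0; 1]; [:: 0; 0; 0; 0; 1]; [:: 0; 0; 1]; [:: 0; 0; 0; 1];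
        [:: 1; 0; 0; -1]; [:: 0; 0; 1; 0; 0; -1]; [:: 0; 1; 0; 0; 1];
        [:: 0; 0; 1; -1]; [:: 0; 1; 0; -2; 1]; [:: 1; 0; -1; 0; 2];
        [:: 1; 0; 0; -1; 1]; [:: 0; 1; -1; 0; 0; 1]; [:: 1; 0; -4; 1];
        [:: 0; 1; -1; 2]; [:: 2; -1; 1]; [:: 1; -4; 0; 1]]].
(* These serve the two exceptional systems. *)
Definition refinements : seq candidate :=
  [:: (zvec [:: 0; 0; 1], [:: (1%N, zvec [:: 0; 1; 0; 0; 1])])].
Definition refined_candidates : seq candidate :=
  [:: (zvec [:: 1],
       [:: (1%N, zvec [:: 0; 1; 0; 0; 1]); (2%N, zvec [:: 0; 0; 1])])].

Lemma foldr_iota_sum (V : nmodType) (G : nat -> V) n :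
  foldr (fun k acc => G k + acc) 0 (iota 0 n) = \sum_(k < n) G k.
Proof.
by rewrite -(big_mkord xpredT) /index_iota subn0 unlock.
Qed.

(** * Soundness of the elimination over a field of characteristic zero *)

Section Soundness.
Variable F : numFieldType.

Definition zF (z : Z) : F := (int_of_Z z)%:~R.
Lemma zF0 : zF 0 = 0. Proof. by []. Qed.
Lemma zF1 : zF (Zpos xH) = 1. Proof. by []. Qed.
Lemma zFD a b : zF (Z.add a b) = zF a + zF b.
Proof. by rewrite /zF -intrD; congr (_%:~R); lia. Qed.
Lemma zFM a b : zF (Z.mul a b) = zF a * zF b.
Proof. by rewrite /zF -intrM; congr (_%:~R); lia. Qed.
Lemma zFN a : zF (Z.opp a) = - zF a.
Proof. by rewrite /zF -intrN; congr (_%:~R); lia. Qed.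
Lemma zF_eq0 a : (zF a == 0) = Z.eqb a Z0.
Proof. by rewrite /zF intr_eq0; case: a => //= p; lia. Qed.
Lemma zF_inj : injective zF.
Proof.
move=> a b /eqP; rewrite -subr_eq0 -zFN -zFD zF_eq0 => /Z.eqb_eq; lia.
Qed.

Fixpoint feval (r : form) (x : nat -> F) : F :=
  if r is c :: r' then zF c * x 0%N + feval r' (fun k => x k.+1) else 0.

Lemma feval_scale a r x : feval (map (Z.mul a) r) x = zF a * feval r x.
Proof.
by elim: r x => [|c r IH] x /=; rewrite ?mulr0 // IH zFM mulrDr mulrA.
Qed.

Lemma feval_lincomb a r b s x :
  feval (lincomb a r b s) x = zF a * feval r x + zF b * feval s x.
Proof.
elim: r s x => [|c r IH] [|d s] x; rewrite /= ?feval_scale ?mulr0 ?add0r ?addr0 //=.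
- by rewrite zFM mulrDr mulrA.
- by rewrite zFM mulrDr mulrA.
by rewrite IH zFD !zFM !mulrDr mulrDl !mulrA addrACA.
Qed.

Lemma feval_add_scaled c r acc x :
  feval (add_scaled c r acc) x = feval acc x + zF c * feval r x.
Proof.
have E : feval (lincomb (Zpos xH) acc c r) x = feval acc x + zF c * feval r x.
  by rewrite feval_lincomb zF1 mul1r.
by case: c E => //=; rewrite mul0r addr0.
Qed.

Lemma feval_fdot c f x :
  feval (fdot c f) x = \sum_(k < 6) zF (c k) * feval (f k) x.
Proof.
rewrite -(foldr_iota_sum (fun k => zF (c k) * feval (f k) x)) /fdot.
elim: (iota 0 6) => //= k s IH.
by rewrite feval_add_scaled IH addrC.
Qed.

Lemma zF_zdot f g : zF (zdot f g) = \sum_(k < 6) zF (f k) * zF (g k).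
Proof.
rewrite -(foldr_iota_sum (fun k => zF (f k) * zF (g k))) /zdot.
elim: (iota 0 6) => //= k s IH.
by rewrite zFD zFM IH.
Qed.

Definition zmx (A : table Z) : 'M[F]_6 := \matrix_(i, j) zF (entry Z0 A i j).
(** Lists shorter than 6, as in [candidates], are completed by zeros. *)
Definition zrow (v : seq Z) : 'rV[F]_6 := \row_j zF (nth Z0 v j).

Lemma zmx_mul A B : zmx (zmul A B) = zmx A *m zmx B.
Proof.
apply/matrixP=> i j; rewrite !mxE entry_tabulate zF_zdot.
by apply: eq_bigr => k _; rewrite !mxE.
Qed.

Lemma zmx_tr A : zmx (ztr A) = (zmx A)^T.
Proof. by apply/matrixP=> i j; rewrite !mxE entry_tabulate. Qed.

Lemma zmx_one : zmx zone = 1%:M.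
Proof.
apply/matrixP=> i j; rewrite !mxE entry_tabulate -val_eqE.
by case: eqP.
Qed.

Lemma all_iotaP n (p : nat -> bool) :
  reflect (forall i : 'I_n, p i) (all p (iota 0 n)).
Proof.
apply: (iffP allP) => [H i | H k]; first by apply: H; rewrite mem_iota ltn_ord.
by rewrite mem_iota => /= kn; apply: (H (Ordinal kn)).
Qed.

Lemma has_iotaP n (p : nat -> bool) :
  reflect (exists i : 'I_n, p i) (has p (iota 0 n)).
Proof.
apply: (iffP hasP) => [[k] | [i Hi]].
  by rewrite mem_iota => /= kn pk; exists (Ordinal kn).
by exists (i : nat) => //; rewrite mem_iota ltn_ord.
Qed.

Lemma zmx_eq A B : zeq A B -> zmx A = zmx B.
Proof.
move=> /all_iotaP E; apply/matrixP=> i j; rewrite !mxE.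
by have /all_iotaP/(_ j)/Z.eqb_eq -> := E i.
Qed.

Lemma zrow_mulE v E : zrow v *m zmx E = \row_j zF (zrow_dot v E j).
Proof.
apply/rowP=> j; rewrite !mxE zF_zdot; apply: eq_bigr => k _.
by rewrite !mxE.
Qed.

Section Equations.
Variable x : nat -> F.

Definition fmx (Y : table form) : 'M[F]_6 :=
  \matrix_(i, j) feval (entry [::] Y i j) x.
Definition ad_mx := fmx ad_table.

Lemma fmx_zfmul A Y : fmx (zfmul A Y) = zmx A *m fmx Y.
Proof.
apply/matrixP=> i j; rewrite !mxE entry_tabulate feval_fdot.
by apply: eq_bigr => k _; rewrite !mxE.
Qed.

Lemma fmx_fzmul Y A : fmx (fzmul Y A) = fmx Y *m zmx A.
Proof.
apply/matrixP=> i j; rewrite !mxE entry_tabulate feval_fdot.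
by apply: eq_bigr => k _; rewrite !mxE mulrC.
Qed.

Lemma zrow_ad v : zrow v *m ad_mx = \row_j feval (row_ad v j) x.
Proof.
apply/rowP=> j; rewrite !mxE feval_fdot; apply: eq_bigr => k _.
by rewrite !mxE.
Qed.

Lemma feval_fzero r y : fzero r -> feval r y = 0.
Proof.
elim: r y => //= c r IH y /andP[]; case: c => // _ /IH ->.
by rewrite mul0r addr0.
Qed.

Fixpoint holds (b : echelon) : Prop :=
  if b is ((l, p), s) :: b' then [/\ zF p != 0, feval s x = 0 & holds b']
  else True.

(** As s(x) = 0, a step multiplies r(x) by the pivot p, which is non-zero. *)
Lemma reduce_eq0 b r : holds b -> feval (reduce b r) x = 0 <-> feval r x = 0.
Proof.
elim: b r => [|[[l p] s] b IH] r //= [p0 s0 /IH {}IH].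
have E c : feval (reduce b (lincomb p r c s)) x = 0 <-> feval r x = 0.
  rewrite IH feval_lincomb s0 mulr0 addr0; split => [/eqP|->]; last by rewrite mulr0.
  by rewrite mulf_eq0 (negbTE p0) => /eqP.
by case: (nth Z0 r l) => [|c|c]; [exact: IH | exact: E | exact: E].
Qed.

Lemma lead_neq0 r l p : lead r = Some (l, p) -> zF p != 0.
Proof.
elim: r l => //= c r IH l; case: c => [|c|c].
- by case: (lead r) IH => // [[l' p']] IH [_ ep]; apply: (IH l'); rewrite ep.
- by case=> _ <-; rewrite zF_eq0.
- by case=> _ <-; rewrite zF_eq0.
Qed.

Lemma holds_rcons b l p s :
  holds b -> zF p != 0 -> feval s x = 0 -> holds (rcons b ((l, p), s)).
Proof.
by elim: b => [|[[l' p'] s'] b IH] //= [p0 s0 hb] pn sn; split => //; apply: IH.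
Qed.

Lemma holds_insert b r : holds b -> feval r x = 0 -> holds (insert b r).
Proof.
move=> hb r0; rewrite /insert; case: ifP => // _.
case E: (lead _) => [[l p]|] //; apply: holds_rcons => //; first exact: lead_neq0 E.
by apply/reduce_eq0.
Qed.

Lemma holds_foldl_insert (T : eqType) (f : T -> form) s b :
  holds b -> {in s, forall k, feval (f k) x = 0} ->
  holds (foldl insert b [seq f k | k <- s]).
Proof.
elim: s b => //= k s IH b hb H; apply: IH => [|l ls].
  by apply: holds_insert => //; apply: H; rewrite mem_head.
by apply: H; rewrite in_cons ls orbT.
Qed.

Lemma vanishes_eq0 b r : holds b -> vanishes b r -> feval r x = 0.
Proof. by move=> hb van; apply/(reduce_eq0 r hb)/feval_fzero. Qed.

(** v N is a combination of vectors killed by N. The coefficients are themselves entries of v N, so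
    the test stays linear in the unknowns although N^2 is quadratic. *)
Lemma killed_twiceP b c : holds b -> killed_twice b c ->
  zrow c.1 *m ad_mx *m ad_mx = 0.
Proof.
case: c => v ks hb; rewrite /killed_twice => /andP[kil comb].
rewrite [(v, ks).1]/=.
have -> : zrow v *m ad_mx =
    \sum_(k <- ks) feval (row_ad v k.1) x *: zrow k.2.
  rewrite zrow_ad; apply/rowP=> j; rewrite mxE summxE.
  move/all_iotaP: comb => comb; have {comb} := vanishes_eq0 hb (comb j).
  set r := row_ad v j.
  (* The folded form is the j-th coordinate of v N minus the proposed combination. *)
  have -> : feval (foldr (fun k acc => add_scaled (Z.opp (nth Z0 k.2 j))
      (row_ad v k.1) acc) r ks) x =
      feval r x - \sum_(k <- ks) (feval (row_ad v k.1) x *: zrow k.2) 0 j.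
    elim: ks {kil} => [|k ks IH] /=; first by rewrite big_nil subr0.
    by rewrite feval_add_scaled IH big_cons !mxE zFN mulNr mulrC opprD addrA addrAC.
  by move/eqP; rewrite subr_eq0 => /eqP.
rewrite mulmx_suml; elim: ks {comb} kil => [|k ks IH]; first by rewrite big_nil.
case/andP=> /all_iotaP kil /IH; rewrite big_cons => ->; rewrite addr0.
rewrite -scalemxAl zrow_ad; apply/rowP=> j.
by rewrite !mxE (vanishes_eq0 hb (kil j)) mulr0.
Qed.

Variable L : 'M[F]_6.
(** What is retained here of L = exp(N): the series stops after its linear term on vectors killed by
    N^2. *)
Hypothesis L_exp : forall v : 'rV_6,
  v *m ad_mx *m ad_mx = 0 -> v *m L = v + v *m ad_mx.
Variable E : table Z.
Hypothesis L_E : L = zmx E.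

Lemma contradictsP b c : holds b -> contradicts b E c -> False.
Proof.
move=> hb /andP[/has_iotaP[j /andP[neq van]] /(killed_twiceP hb)/L_exp].
rewrite L_E zrow_mulE zrow_ad => /rowP/(_ j).
rewrite !mxE (vanishes_eq0 hb van) addr0 => /zF_inj eq.
by rewrite eq Z.eqb_refl in neq.
Qed.

Lemma holds_refine b c : holds b -> holds (refine E b c).
Proof.
move=> hb; rewrite /refine; case: ifP => // /andP[/all_iotaP fx].
move=> /(killed_twiceP hb)/L_exp; rewrite L_E zrow_mulE zrow_ad => eq.
apply: holds_foldl_insert => // j; rewrite mem_iota => /= j6.
move/rowP/(_ (Ordinal j6)): eq; rewrite !mxE /=.
have /Z.eqb_eq -> := fx (Ordinal j6).
by move/eqP; rewrite -subr_eq0 opprD addNKr oppr_eq0 => /eqP.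
Qed.

Lemma holds_differences U Y :
  fmx U = fmx Y -> holds (foldl insert [::] (differences U Y)).
Proof.
move=> UY; refine (holds_foldl_insert (f := difference U Y) (b := [::]) I _).
move=> ij /allpairsP[[j i] [_ i6 ->]] {ij}; rewrite mem_iota in i6.
have j6 : ((i + j) %% 6 < 6)%N by rewrite ltn_mod.
move/matrixP/(_ (Ordinal i6) (Ordinal j6)): UY; rewrite !mxE => UY.
by rewrite feval_lincomb UY -mulrDl -zFD mul0r.
Qed.

Lemma not_expP cs rs cs' Pt U M Y :
  fmx U = fmx Y -> E = zmul Pt M -> not_exp cs rs cs' Pt U (M, Y) -> False.
Proof.
move=> eqUY eqE; rewrite /not_exp -eqE.
set b := foldl insert _ _.
have hb : holds b by refine (holds_differences _).
(* The echelon system is made opaque, so that no tactic evaluates it. *)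
clearbody b.
have contra b' c : holds b' -> has (contradicts b' E) c -> False.
  move=> hb'; elim: c => //= c c' IH /orP[]; [exact: contradictsP | exact: IH].
case/orP=> [|]; first exact: contra.
apply: contra; elim: rs b hb => //= c rs IH b hb.
by apply: IH; apply: holds_refine.
Qed.
End Equations.

(** With V the inverse of M = P L, multiplying P L V = 1 by P^T gives L V = P^T; hence M N V = P L N
    V = P N L V = P N P^T. *)
Lemma conj_table_eq M x (L P : 'M[F]_6) :
  zeq (zmul M (zsympl_inv M)) zone ->
  P *m L = zmx M -> P^T *m P = 1%:M -> L *m ad_mx x = ad_mx x *m L ->
  fmx x (conj_table M) = P *m ad_mx x *m P^T.
Proof.
move=> /zmx_eq; rewrite zmx_mul zmx_one => MV PL PP comm.
have LV : L *m zmx (zsympl_inv M) = P^T.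
  by rewrite -[L]mul1mx -PP -!mulmxA [P *m _]mulmxA PL MV mulmx1.
rewrite fmx_fzmul fmx_zfmul -PL -/(ad_mx x) -[P *m L *m _]mulmxA comm !mulmxA.
by rewrite -[_ *m L *m _]mulmxA LV.
Qed.

(** Orthogonality is among the conditions evaluated by [never_exp], from which it is extracted. *)
Lemma turn_table_orthogonal I cs rs cs' (M : I -> table Z) r pi k :
  never_exp cs rs cs' M r -> pi \in perms3 -> k \in turns ->
  (zmx (turn_table pi k))^T *m zmx (turn_table pi k) = 1%:M.
Proof.
rewrite /never_exp => /andP[_ /allP H] /H /allP {}H /H /andP[/zmx_eq + _].
by rewrite zmx_mul zmx_tr zmx_one.
Qed.

Lemma never_expP (I : eqType) cs rs cs' (M : I -> table Z) r i pi k x L :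
  never_exp cs rs cs' M r -> i \in r -> pi \in perms3 -> k \in turns ->
  L *m ad_mx x = ad_mx x *m L ->
  (forall v : 'rV_6, v *m ad_mx x *m ad_mx x = 0 -> v *m L = v + v *m ad_mx x) ->
  zmx (turn_table pi k) *m L = zmx (M i) -> False.
Proof.
move=> ne ir pi3 kt comm L_exp PL.
have PP := turn_table_orthogonal ne pi3 kt.
case/andP: ne => /allP /(_ i ir) MV.
have conjY := conj_table_eq MV PL PP comm.
move=> /allP /(_ pi pi3) /allP /(_ k kt) /andP[_].
rewrite all_map => /allP /(_ i ir).
have eqL : L = zmx (zmul (ztr (turn_table pi k)) (M i)).
  by rewrite zmx_mul zmx_tr -PL mulmxA PP mul1mx.
(* Only the equation just proved about the table of M N M^-1 is kept, so that the table is never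
   unfolded. *)
move: conjY; rewrite /preim /=; move: (conj_table (M i)) => Y conjY.
apply: (not_expP L_exp eqL _ erefl).
by rewrite conjY fmx_fzmul fmx_zfmul zmx_tr.
Qed.
End Soundness.

(** * The integer matrix of the monomial part *)

Section Monomials.
Variables (R : realType) (hbar : R[i]).

(** Linear parts do not see scalars: powers of q and factors e^lambda are absorbed into c. *)
Definition monomial_at n (B : 'M[int]_n) (f : qtorus hbar B) (a : 'rV[int]_n) :=
  exists2 c : R[i], c != 0 & f = c *: qmono a.

Section Fixed.
Variables (n : nat) (B : 'M[int]_n).
Implicit Types (f g : qtorus hbar B) (a b : 'rV[int]_n).

Lemma qpow_neq0 (m : int) : cexp hbar ^ m != 0.
Proof. by rewrite expfz_neq0 // cexp_neq0. Qed.

Lemma monomial_at_mono a : monomial_at (qmono a : qtorus hbar B) a.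
Proof. by exists 1; rewrite ?oner_eq0 // scale1r. Qed.

Lemma monomial_at_scale c f a :
  c != 0 -> monomial_at f a -> monomial_at (c *: f) a.
Proof. by move=> c0 [d d0 ->]; exists (c * d); rewrite ?mulf_neq0 // scalerA. Qed.

Lemma monomial_at_mul f g a b :
  monomial_at f a -> monomial_at g b -> monomial_at (f * g) (a + b).
Proof.
move=> [c c0 ->] [d d0 ->]; exists (c * d * cexp hbar ^ bform B a b).
  by rewrite !mulf_neq0 ?qpow_neq0.
by rewrite -scalerAl -scalerAr qmonoM !scalerA.
Qed.

(** The monomials form a basis; the coefficients at a are compared. *)
Lemma monomial_at_inj f a b : monomial_at f a -> monomial_at f b -> a = b.
Proof.
move=> [c c0 ->] [d d0]; rewrite /qmono !qtermZ !qtermE => /monalg.malgP/(_ a).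
rewrite !monalg.mcoeffU eqxx !mulr1 mulr1n; case: eqP => [->//|_ /eqP].
by rewrite mulr0n (negbTE c0).
Qed.

Lemma monomial_at_unit f a : monomial_at f a -> f \is a GRing.unit.
Proof.
move=> [c c0 ->]; apply/unitrP.
(* Y^a Y^(-a) = q^B(a,-a), which the scalar compensates. *)
exists ((c * cexp hbar ^ bform B a (- a))^-1 *: qmono (- a)).
have q0 := qpow_neq0 (bform B a (- a)).
have e : bform B (- a) a = bform B a (- a).
  by rewrite /bform !mulNmx linearN /= mulmxN.
rewrite -!scalerAl -!scalerAr !qmonoM !scalerA e addrN addNr.
have cq0 : c * cexp hbar ^ bform B a (- a) != 0 by rewrite mulf_neq0.
by rewrite -mulrA mulVf // mulrAC mulfV // scale1r.
Qed.

Lemma monomial_at_inv f a : monomial_at f a -> monomial_at f^-1 (- a).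
Proof.
move=> fa; have U := monomial_at_unit fa; case: fa U => c c0 -> U.
exists ((c * cexp hbar ^ bform B a (- a))^-1).
  by rewrite invr_neq0 ?mulf_neq0 ?qpow_neq0.
apply: (mulrI U); rewrite mulrV // -scalerAl -scalerAr qmonoM !scalerA addrN.
by rewrite mulrAC mulfV ?scale1r ?mulf_neq0 ?qpow_neq0.
Qed.

Lemma monomial_at_expz f a (m : int) :
  monomial_at f a -> monomial_at (f ^ m) (a *~ m).
Proof.
move=> fa; have pos k : monomial_at (f ^+ k) (a *+ k).
  elim: k => [|k IH]; first by rewrite expr0 mulr0n; exact: monomial_at_mono.
  by rewrite exprS mulrS; apply: monomial_at_mul.
case: m => k; first exact: pos.
by rewrite NegzE mulrNz /exprz; apply: monomial_at_inv.
Qed.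
End Fixed.

(** The exponents whose monomials satisfy the claim form a subgroup of Z^n, which contains the basis
    vectors by hypothesis. *)
Lemma monomial_at_morph n m (B : 'M[int]_n) (B' : 'M[int]_m)
    (f : {lrmorphism qtorus hbar B -> qtorus hbar B'}) (N : 'M[int]_(n, m)) :
  (forall i, monomial_at (f (qgen i)) (row i N)) ->
  forall y a, monomial_at y a -> monomial_at (f y) (a *m N).
Proof.
move=> fN y a [c c0 ->]; rewrite linearZ; apply: monomial_at_scale => //.
have addP b d : monomial_at (f (qmono b)) (b *m N) ->
    monomial_at (f (qmono d)) (d *m N) ->
    monomial_at (f (qmono (b + d))) ((b + d) *m N).
  move=> Hb Hd; have := monomial_at_mul Hb Hd.
  rewrite -rmorphM qmonoM /= linearZ -mulmxDl => H.
  have q0 := qpow_neq0 (bform B b d).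
  have := monomial_at_scale (invr_neq0 q0) H.
  by rewrite scalerA mulVf // scale1r.
have zero : monomial_at (f (qmono 0)) (0 *m N).
  by rewrite mul0mx rmorph1; exact: monomial_at_mono.
have oppP b : monomial_at (f (qmono b)) (b *m N) ->
    monomial_at (f (qmono (- b))) (- b *m N).
  move=> Hb; have := monomial_at_inv (monomial_at_mono B b).
  case=> d d0 e; have : monomial_at (f (qmono b))^-1 (- (b *m N)).
    exact: monomial_at_inv.
  rewrite -rmorphV ?(monomial_at_unit (monomial_at_mono B b)) // e /= linearZ -mulNmx.
  by move/(monomial_at_scale (invr_neq0 d0)); rewrite scalerA mulVf // scale1r.
have scaleP b (k : int) : monomial_at (f (qmono b)) (b *m N) ->
    monomial_at (f (qmono (b *~ k))) (b *~ k *m N).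
  move=> Hb; have pos l : monomial_at (f (qmono (b *+ l))) (b *+ l *m N).
    elim: l => [|l IH]; first by rewrite mulr0n.
    by rewrite mulrS; apply: addP.
  case: k => l; first exact: pos.
  by rewrite NegzE mulrNz; apply: oppP; apply: pos.
have -> : a = \sum_i delta_mx 0 i *~ a 0 i.
  rewrite [LHS]row_sum_delta; apply: eq_bigr => i _.
  by rewrite -scaler_int intz.
elim/big_ind: _ => // i _; apply: scaleP; rewrite -rowE; exact: fN.
Qed.
End Monomials.

(** * Exponent matrices as computable tables *)

Definition imul m p n (A B : table int) : table int := tabulate m n (fun i j =>
  foldr (fun k acc => entry 0 A i k * entry 0 B k j + acc) 0 (iota 0 p)).
Definition imx m n (A : table int) : 'M[int]_(m, n) :=
  \matrix_(i, j) entry 0 A i j.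

Lemma imx_mul m p n A B : imx m n (imul m p n A B) = imx m p A *m imx p n B.
Proof.
apply/matrixP=> i j; rewrite !mxE entry_tabulate.
rewrite (foldr_iota_sum (fun k => entry 0 A i k * entry 0 B k j)).
by apply: eq_bigr => k _; rewrite !mxE.
Qed.

Definition imutation (k : nat) (A : table int) : table int := tabulate 9 9 (fun i j =>
  if (i == k) || (j == k) then - entry 0 A i j
  else entry 0 A i j + ((`|entry 0 A i k| * entry 0 A k j
                         + entry 0 A i k * `|entry 0 A k j|) %/ 2)%Z).

Lemma imx_mutation (k : 'I_9) A : mutation k (imx 9 9 A) = imx 9 9 (imutation k A).
Proof. by apply/matrixP=> i j; rewrite !mxE entry_tabulate. Qed.

Definition b1 : table int := tabulate 9 9 (fun i j =>
  ((i.+1, j.+1) \in arrows)%:Z - ((j.+1, i.+1) \in arrows)%:Z).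
Definition b2 := imutation 7 b1.
Definition b3 := imutation 4 b2.
Definition b4 := imutation 3 b3.

Lemma B1E : B1 = imx 9 9 b1.
Proof. by apply/matrixP=> i j; rewrite !mxE entry_tabulate. Qed.
Lemma B2E : B2 = imx 9 9 b2. Proof. by rewrite /B2 B1E imx_mutation. Qed.
Lemma B3E : B3 = imx 9 9 b3. Proof. by rewrite /B3 B2E imx_mutation. Qed.
Lemma B4E : B4 = imx 9 9 b4. Proof. by rewrite /B4 B3E imx_mutation. Qed.

(** Row i is the exponent of the image of the generator Y'_i, the power of q being dropped. *)
Definition tau_table (k : nat) (e : bool) (A : table int) : table int :=
  tabulate 9 9 (fun i j =>
    if i == k then - (j == k)%:Z
    else (i == j)%:Z + Num.max 0 (sign_int e * entry 0 A i k) *+ (j == k)).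
Definition sigma_table : table int := tabulate 9 9 (fun i j =>
  (j == if i == 3 then 4 else if i == 4 then 3 else i)%N%:Z).

(* Rows: the coordinates of phi(Y_r), resp. phi(Y'_r), in u_1, u_2, u_3, w_1,
   w_2, w_3. *)
Definition phi_table : table int :=
  [:: [:: 0; 0; 0; 0; -1; 0]; [:: 0; 1; 0; 0; 0; 0]; [:: 0; 0; 0; -1; 0; 0];
      [:: 1; -1; 0; 0; 0; 0]; [:: 0; 0; 0; 0; 1; -1]; [:: 0; 0; 1; 0; 0; 0];
      [:: -1; 0; 0; 0; 0; 0]; [:: 0; 0; -1; 1; 0; 0]; [:: 0; 0; 0; 0; 0; 1]].
Definition phi'_table : table int :=
  [:: [:: 0; 0; 0; 0; 0; -1]; [:: 1; 0; 0; 0; 0; 0]; [:: 0; 0; -1; 0; 0; 0];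
      [:: -1; 1; 0; 0; 0; 0]; [:: 0; 0; 0; 0; -1; 1]; [:: 0; 0; 0; 1; 0; 0];
      [:: 0; -1; 0; 0; 0; 0]; [:: 0; 0; 1; -1; 0; 0]; [:: 0; 0; 0; 0; 1; 0]].
(** Up to the lambda_j, the exponentials of u_1, u_2, u_3, w_1, w_2, w_3 are the images of Y'_2,
    1/Y'_7, 1/Y'_3, Y'_6, Y'_9, 1/Y'_1. *)
Definition phi'_left_inverse : table int := tabulate 6 9 (fun i j =>
  nth 0 [:: (j == 1)%N%:Z; - (j == 6)%N%:Z; - (j == 2)%N%:Z; (j == 5)%N%:Z;
            (j == 8)%N%:Z; - (j == 0)%N%:Z] i).

(* phi' has rank 6, so M is read off from phi' M = tau phi. *)
Definition uw_table (e1 e2 e3 e4 : bool) : table int :=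
  imul 6 9 6 phi'_left_inverse
    (imul 9 9 6 (imul 9 9 9 (imul 9 9 9 (imul 9 9 9 (imul 9 9 9 sigma_table
      (tau_table 7 e4 b4)) (tau_table 3 e3 b3)) (tau_table 4 e2 b2))
      (tau_table 7 e1 b1)) phi_table).

Section Transformation.
Variables (R : realType) (hbar : R[i]).

Lemma tau_monomial (k : 'I_9) B A e
    (f : {lrmorphism qtorus hbar (mutation k B) -> qtorus hbar B}) :
  B = imx 9 9 A -> is_tau k B e f ->
  forall i, monomial_at (f (qgen i)) (row i (imx 9 9 (tau_table k e A))).
Proof.
move=> BA [fk fi] i; have [-> | ik] := eqVneq i k.
  rewrite fk; have -> : row k (imx 9 9 (tau_table k e A)) = - delta_mx 0 k.
    apply/rowP=> j; rewrite !mxE entry_tabulate !eqxx /= -val_eqE /=.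
    by case: (_ == _).
  by apply: monomial_at_inv; exact: monomial_at_mono.
rewrite (fi i ik); apply: monomial_at_scale; first exact: qpow_neq0.
set p := Num.max _ _.
have -> : row i (imx 9 9 (tau_table k e A)) = delta_mx 0 i + delta_mx 0 k *~ p.
  apply/rowP=> j; rewrite !mxE entry_tabulate val_eqE (negbTE ik) eq_sym !val_eqE /=.
  rewrite /p BA mxE -[in RHS]scaler_int !mxE /=.
  by rewrite natz intz mulr_natr.
by apply: monomial_at_mul; [|apply: monomial_at_expz]; exact: monomial_at_mono.
Qed.

Lemma sigma_monomial (f : {lrmorphism qtorus hbar B6 -> qtorus hbar B5}) :
  is_sigma45 f -> forall i, monomial_at (f (qgen i)) (row i (imx 9 9 sigma_table)).
Proof.
move=> fs i; rewrite fs.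
have -> : row i (imx 9 9 sigma_table) = delta_mx 0 (tperm (ix 4) (ix 5) i).
  apply/rowP=> j; rewrite !mxE entry_tabulate /= -val_eqE /= natz.
  case: tpermP => [-> | -> | i3 i4] //=.
  have /negbTE -> : (i != 3 :> nat).
    by apply: contra_notN i3 => /eqP i3; apply/val_inj.
  have /negbTE -> : (i != 4 :> nat).
    by apply: contra_notN i4 => /eqP i4; apply/val_inj.
  by [].
exact: monomial_at_mono.
Qed.

Variable lambda : 'I_3 -> R[i].

Definition form_row (l : linform) : 'rV[int]_(3 + 3) := row_mx l.1.1 l.1.2.

Lemma expform_monomial l :
  monomial_at (expform hbar lambda l : qtorus hbar Omega) (form_row l).
Proof. by apply: monomial_at_scale; [exact: cexp_neq0|exact: monomial_at_mono]. Qed.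

Definition gen_image (T : uwmap) (i : 'I_(3 + 3)) : linform :=
  match fintype.split i with inl j => im_u T j | inr j => im_w T j end.

Lemma phi_row r : (r < 9)%N ->
  form_row (nth 0 phi_form r) =
  row_mx (\row_j entry 0 phi_table r j) (\row_j entry 0 phi_table r (3 + j)).
Proof.
move=> r9; congr row_mx; apply/rowP=> j.
  by do 9?[case: r r9 => [_|r r9]]; rewrite //= !mxE; case: j => [[|[|[]]]].
by do 9?[case: r r9 => [_|r r9]]; rewrite //= !mxE; case: j => [[|[|[]]]].
Qed.

Lemma phi'_row r : (r < 9)%N ->
  form_row (nth 0 phi'_form r) =
  row_mx (\row_j entry 0 phi'_table r j) (\row_j entry 0 phi'_table r (3 + j)).
Proof.
move=> r9; congr row_mx; apply/rowP=> j.
  by do 9?[case: r r9 => [_|r r9]]; rewrite //= !mxE; case: j => [[|[|[]]]].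
by do 9?[case: r r9 => [_|r r9]]; rewrite //= !mxE; case: j => [[|[|[]]]].
Qed.

Lemma row_imx_split m (A : table int) (r : 'I_m) :
  row_mx (\row_j entry 0 A r j) (\row_j entry 0 A r (3 + j)) =
  row r (imx m (3 + 3) A).
Proof.
apply/rowP=> j; case: (fintype.split_ordP j) => k ->;
  by rewrite (row_mxEl, row_mxEr) !mxE.
Qed.

(** Both sides of hatT phi' = phi tau send Y'_r to a monomial. Comparing exponents gives phi' M =
    tau phi, and the left inverse of phi' isolates M. *)
Lemma tau_uw_table e1 e2 e3 e4 (T : uwmap) :
  is_tau_uw hbar lambda e1 e2 e3 e4 T ->
  forall i, form_row (gen_image T i) = row i (imx 6 6 (uw_table e1 e2 e3 e4)).
Proof.
case=> tau [phi [phi' [hatT []]]].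
case=> t1 [t2 [t3 [t4 [sigma [[h1 h2 h3 h4] [hs htau]]]]]] hphi hphi' hT comm.
pose MT : 'M[int]_(3 + 3) := \matrix_i form_row (gen_image T i).
have m4 := monomial_at_morph (tau_monomial B4E h4).
have m3 := monomial_at_morph (tau_monomial B3E h3).
have m2 := monomial_at_morph (tau_monomial B2E h2).
have m1 := monomial_at_morph (tau_monomial B1E h1).
(* [W3] is restated as the quantum torus of Omega, so that the lemmas on monomials apply. *)
pose phiq : {lrmorphism qtorus hbar B1 -> qtorus hbar Omega} := phi.
pose phiq' : {lrmorphism qtorus hbar B6 -> qtorus hbar Omega} := phi'.
pose hTq : {lrmorphism qtorus hbar Omega -> qtorus hbar Omega} := hatT.
have mphi : forall y a, monomial_at y a ->
    monomial_at (phiq y) (a *m imx 9 (3 + 3) phi_table).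
  apply: monomial_at_morph => i; rewrite /phiq hphi -row_imx_split -phi_row //.
  exact: expform_monomial.
have mphi' : forall y a, monomial_at y a ->
    monomial_at (phiq' y) (a *m imx 9 (3 + 3) phi'_table).
  apply: monomial_at_morph => i; rewrite /phiq' hphi' -row_imx_split -phi'_row //.
  exact: expform_monomial.
have mT : forall y a, monomial_at y a -> monomial_at (hTq y) (a *m MT).
  apply: monomial_at_morph => i; rewrite rowK.
  (* Up to a scalar, the i-th generator of this torus is the exponential of some u_k or w_k. *)
  have [l [lE hl]] : exists l, form_row l = delta_mx 0 i /\
      hatT (expform hbar lambda l) = expform hbar lambda (gen_image T i).
    rewrite /gen_image; case: fintype.split_ordP => k ->; have [hu hw] := hT k.
      by exists (fu k); split => //; rewrite delta_mx_lshift.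
    by exists (fw k); split => //; rewrite delta_mx_rshift.
  have : monomial_at (hTq (expform hbar lambda l)) (form_row (gen_image T i)).
    by rewrite /hTq hl; exact: expform_monomial.
  have : expform hbar lambda l =
      cexp (lambda_part lambda l) *: qgen i :> qtorus hbar Omega.
    by rewrite /qgen -lE.
  move=> -> /=; rewrite linearZ => /(monomial_at_scale (invr_neq0 (cexp_neq0 _))).
  by move/(_ (lambda_part lambda l)); rewrite scalerA mulVf ?scale1r ?cexp_neq0.
suff E : MT = imx (3 + 3) (3 + 3) (uw_table e1 e2 e3 e4).
  by move=> i; rewrite -E rowK.
have left : imx (3 + 3) 9 phi'_left_inverse *m imx 9 (3 + 3) phi'_table = 1%:M.
  rewrite -imx_mul; apply/matrixP=> i j; rewrite !mxE.
  by case: i => [[|[|[|[|[|[|]]]]]] ?] //; case: j => [[|[|[|[|[|[|]]]]]] ?].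
rewrite -[LHS]mul1mx -left -mulmxA !imx_mul -!mulmxA; congr (_ *m _).
apply/row_matrixP=> r; rewrite !rowE !mulmxA.
have y0 : monomial_at (qgen r : qtorus hbar B6) (delta_mx 0 r).
  exact: monomial_at_mono.
have := monomial_at_inj (mT _ _ (mphi' _ _ y0)) _; apply.
rewrite /hTq /phiq' comm htau; apply: (mphi); apply: m1; apply: m2; apply: m3.
apply: m4; rewrite -rowE; exact: sigma_monomial.
Qed.
End Transformation.

(** * Exponential series *)

Section Convergence.
Variables (F : numFieldType) (d : nat) (D : 'M[F]_d).

Definition act (v : 'rV[F]_d) := v *m D.

Definition partial_exp n (v : 'rV[F]_d) : 'rV[F]_d :=
  \sum_(k < n) (k`!%:R)^-1 *: iter k act v.

(** This says l = v exp(D) for a single vector, coordinate by coordinate; no matrix exponential is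
    formed. *)
Definition exp_to (v l : 'rV[F]_d) : Prop :=
  forall j, ((fun n => partial_exp n v 0 j) @ \oo --> l 0 j)%classic.

Lemma iter_mulmx_lin k a v v' :
  iter k act (a *: v + v') = a *: iter k act v + iter k act v'.
Proof. by elim: k => //= k ->; rewrite /act mulmxDl -scalemxAl. Qed.

Lemma partial_exp_lin n a v v' :
  partial_exp n (a *: v + v') = a *: partial_exp n v + partial_exp n v'.
Proof.
rewrite scaler_sumr -big_split; apply: eq_bigr => k _ /=.
by rewrite iter_mulmx_lin scalerDr !scalerA mulrC.
Qed.

Lemma partial_exp_mul n v : partial_exp n (v *m D) = partial_exp n v *m D.
Proof.
rewrite mulmx_suml; apply: eq_bigr => k _; rewrite -scalemxAl; congr (_ *: _).
by rewrite -[v *m D]/(act v) -iterSr.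
Qed.

Lemma exp_to_unique v l l' : exp_to v l -> exp_to v l' -> l = l'.
Proof.
move=> Hl Hl'; apply/rowP=> j.
move: (Hl j) (Hl' j); exact: (@cvg_unique _ (@norm_hausdorff F F^o) _ _).
Qed.

Lemma exp_to_lin a v v' l l' :
  exp_to v l -> exp_to v' l' -> exp_to (a *: v + v') (a *: l + l').
Proof.
move=> Hl Hl' j; rewrite !mxE.
under eq_fun do rewrite partial_exp_lin !mxE.
by apply: (cvgD (V := F^o)); [apply: cvgMl_tmp; exact: Hl | exact: Hl'].
Qed.

Lemma exp_to_mul v l : exp_to v l -> exp_to (v *m D) (l *m D).
Proof.
move=> Hl j; rewrite mxE; under eq_fun do rewrite partial_exp_mul mxE.
apply: (@cvg_big F^o _ +%R); first exact: add_continuous.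
by move=> k _; apply: cvgMr_tmp; exact: Hl.
Qed.

Lemma partial_exp_square0 n v : v *m D *m D = 0 -> (1 < n)%N ->
  partial_exp n v = v + v *m D.
Proof.
move=> DD; have it k : iter k.+2 act v = 0.
  by elim: k => [|k IH]; rewrite iterS ?IH /act /= /act ?mul0mx.
case: n => [|[|n]] // _; rewrite /partial_exp big_ord_recl big_ord_recl big1.
  by rewrite /= invr1 !scale1r addr0.
by move=> k _; rewrite it scaler0.
Qed.

Lemma exp_to_square0 v : v *m D *m D = 0 -> exp_to v (v + v *m D).
Proof.
move=> DD j; apply: (cvg_near_cst (U := F^o)).
by exists 2%N => // n /= n2; rewrite partial_exp_square0.
Qed.

Lemma exp_to_sum (I : finType) (c : I -> F) (v l : I -> 'rV[F]_d) :
  (forall i, exp_to (v i) (l i)) ->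
  exp_to (\sum_i c i *: v i) (\sum_i c i *: l i).
Proof.
move=> H; apply: (big_ind2 exp_to) => [|v1 l1 v2 l2 H1 H2|i _].
- by have := exp_to_square0 (v := 0); rewrite !mul0mx addr0; apply.
- by rewrite -[v1]scale1r -[l1]scale1r; apply: exp_to_lin.
have := exp_to_square0 (v := 0); rewrite !mul0mx addr0 => /(_ erefl) H0.
by rewrite -[c i *: v i]addr0 -[c i *: l i]addr0; apply: exp_to_lin.
Qed.

(** As v = v P^T P is a combination of the rows of P, the limits at these rows extend to v by
    linearity. *)
Lemma exp_to_mx (P M : 'M[F]_d) v : P^T *m P = 1%:M ->
  (forall i, exp_to (row i P) (row i M)) -> exp_to v (v *m (P^T *m M)).
Proof.
move=> PP H; rewrite mulmxA mulmx_sum_row -[v in exp_to v]mulmx1 -PP mulmxA.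
by rewrite [X in exp_to X]mulmx_sum_row; apply: exp_to_sum.
Qed.
End Convergence.

(** The matrix L = P^T M gives the limit of the series at every vector, and so meets the demands of
    [never_expP]. *)
Lemma exp_to_never_exp (F : numFieldType) (I : eqType) cs rs cs'
    (M : I -> table Z) r i pi k (x : nat -> F) :
  never_exp cs rs cs' M r -> i \in r -> pi \in perms3 -> k \in turns ->
  (forall j,
    exp_to (ad_mx x) (row j (zmx F (turn_table pi k))) (row j (zmx F (M i)))) ->
  False.
Proof.
move=> ne ir pi3 kt H; set P := zmx F (turn_table pi k) in H.
have PP : P^T *m P = 1%:M by apply: turn_table_orthogonal ne pi3 kt.
have Hv v := exp_to_mx (v := v) PP H; move: Hv.
move eL: (P^T *m zmx F (M i)) => L Hv.
apply: (never_expP (L := L) ne ir pi3 kt) => [|v /exp_to_square0|].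
(* Both e_j L N and e_j N L are limits of the series at e_j N. *)
- apply/row_matrixP => j; rewrite !rowE !mulmxA.
  apply: (exp_to_unique (D := ad_mx x) (v := delta_mx 0 j *m ad_mx x)).
    by apply: exp_to_mul; apply: Hv.
  exact: Hv.
- by apply: exp_to_unique; apply: Hv.
by rewrite -eL mulmxA (mulmx1C PP) mul1mx.
Qed.

(** * Adjoint actions on the canonical variables *)

Section Adjoint.
Variables (R : realType) (hbar : R[i]) (A : algType R[i]) (u w : 'I_3 -> A).
Local Notation C := R[i].
Local Notation V := 'rV[C]_(3 + 3 + 1).
Hypothesis hbar_neq0 : hbar != 0.
Hypothesis ccr : canonical_commutation hbar u w.
Local Notation bracket a b := (a * b - b * a).

Definition gen (i : 'I_(3 + 3)) : A :=
  match fintype.split i with inl j => u j | inr j => w j end.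

Lemma gen_u i : gen (lshift 3 i) = u i.
Proof. by rewrite /gen -[lshift 3 i]/(unsplit (inl i)) unsplitK. Qed.

Lemma gen_w i : gen (rshift 3 i) = w i.
Proof. by rewrite /gen -[rshift 3 i]/(unsplit (inr i)) unsplitK. Qed.

Definition OmegaC : 'M[C]_(3 + 3) := map_mx intr Omega.

Lemma OmegaCE : OmegaC = block_mx 0 1%:M (- 1%:M) 0.
Proof.
by rewrite /OmegaC /Omega map_block_mx map_mx0 map_mxN map_mx1.
Qed.

Lemma OmegaC_sqr : OmegaC *m OmegaC = - 1%:M.
Proof.
rewrite OmegaCE mulmx_block !mulmx0 !mul0mx !add0r !addr0 mulmx1 mul1mx.
by rewrite (scalar_mx_block 3 3 1) opp_block_mx oppr0.
Qed.

Lemma gen_comm i j : bracket (gen i) (gen j) = (2 * hbar * OmegaC i j)%:A.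
Proof.
rewrite OmegaCE /gen; case: (fintype.split_ordP i) => a ->;
  case: (fintype.split_ordP j) => b ->.
- have [_ -> _] := ccr a b; by rewrite block_mxEul mxE mulr0 scale0r.
- have [-> _ _] := ccr a b; by rewrite block_mxEur mxE.
- have [E _ _] := ccr b a; rewrite block_mxEdl !mxE mulrN scaleNr eq_sym -E.
  by rewrite opprB.
by have [_ _ ->] := ccr a b; rewrite block_mxEdr mxE mulr0 scale0r.
Qed.

Definition lin (x : 'rV[C]_(3 + 3)) : A := \sum_i x 0 i *: gen i.

Lemma affineE v : affine u w v = lin (lsubmx v) + (v 0 pos_c)%:A.
Proof.
rewrite /affine /lin big_split_ord /= -big_split; congr (_ + _).
apply: eq_bigr => i _ /=.
by rewrite gen_u gen_w !mxE.
Qed.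

Lemma lin_lin a x y : lin (a *: x + y) = a *: lin x + lin y.
Proof.
rewrite /lin scaler_sumr -big_split; apply: eq_bigr => i _.
by rewrite !mxE scalerDl scalerA; reflexivity.
Qed.

Lemma lin0 : lin 0 = 0.
Proof. by rewrite /lin big1 // => i _; rewrite mxE scale0r. Qed.

Lemma linD : {morph lin : x y / x + y}.
Proof. by move=> x y; rewrite -[x]scale1r lin_lin !scale1r. Qed.

Lemma linZ a x : lin (a *: x) = a *: lin x.
Proof. by rewrite -[a *: x]addr0 lin_lin lin0 !addr0. Qed.

Lemma affine_lin a v v' :
  affine u w (a *: v + v') = a *: affine u w v + affine u w v'.
Proof.
have E : lsubmx (a *: v + v') = a *: lsubmx v + lsubmx v' by rewrite linearP.
rewrite !affineE E lin_lin !mxE scalerDl scalerDr addrACA.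
by rewrite -[(a * _)%:A]scalerA.
Qed.

Lemma affine0 : affine u w 0 = 0.
Proof. by have := affine_lin (-1) 0 0; rewrite scaler0 add0r scaleN1r addNr. Qed.

Lemma comm_scalar (K : A) (c : C) : bracket K c%:A = 0.
Proof. by rewrite -scalerAr -scalerAl mulr1 mul1r subrr. Qed.

Lemma lin_comm x j : bracket (lin x) (gen j) = (2 * hbar * (x *m OmegaC) 0 j)%:A.
Proof.
rewrite /lin mulr_suml mulr_sumr -sumrB mxE mulr_sumr scaler_suml.
apply: eq_bigr => i _; rewrite -scalerAl -scalerAr -scalerBr gen_comm scalerA.
by congr (_ *: _); ring.
Qed.

(** The u_i, the w_i and 1 are linearly independent in A: since hbar is non-zero and Omega
    invertible, brackets with the generators recover the linear part, and then the constant is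
    left. *)
Lemma affine_eq0 v : affine u w v = 0 -> v = 0.
Proof.
move=> v0.
have l0 : lsubmx v = 0.
  have : lsubmx v *m OmegaC = 0.
    apply/rowP=> j; rewrite [RHS]mxE; have := lin_comm (lsubmx v) j.
    have -> : lin (lsubmx v) = - (v 0 pos_c)%:A.
      by apply/eqP; rewrite -addr_eq0 -affineE v0.
    rewrite mulNr mulrN opprK addrC comm_scalar => /esym/eqP.
    rewrite scaler_eq0 oner_eq0 orbF !mulf_eq0 pnatr_eq0 (negbTE hbar_neq0).
    by move/eqP.
  move/(congr1 (mulmx^~ OmegaC)); rewrite -mulmxA mul0mx OmegaC_sqr.
  by rewrite mulmxN mulmx1 => /eqP; rewrite oppr_eq0 => /eqP.
have c0 : v 0 pos_c = 0.
  move: v0; rewrite affineE l0 /lin big1 => [|i _]; last by rewrite mxE scale0r.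
  by rewrite add0r => /eqP; rewrite scaler_eq0 oner_eq0 orbF => /eqP.
rewrite -[v]hsubmxK l0; apply/rowP=> j; rewrite mxE.
case: (fintype.split_ordP j) => k -> ; rewrite !mxE //.
by rewrite (_ : rshift _ k = pos_c) ?c0 ?mxE // (ord1 k).
Qed.

Lemma affine_inj : injective (affine u w).
Proof.
move=> v v' E; apply/eqP; rewrite -subr_eq0; apply/eqP/affine_eq0.
by rewrite addrC -scaleN1r affine_lin E scaleN1r addNr.
Qed.

Section Ad.
Variables (K : A) (D : 'M[C]_(3 + 3 + 1)).
Hypothesis KD : forall v,
  (2 * hbar)^-1 *: bracket K (affine u w v) = affine u w (v *m D).

Lemma iter_ad k v :
  iter k (fun z => (2 * hbar)^-1 *: bracket K z) (affine u w v) =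
  affine u w (iter k (act D) v).
Proof. by elim: k => //= k ->; rewrite KD. Qed.

Lemma affine_partial_exp n v :
  \sum_(k < n) (k`!%:R)^-1 *: iter k (fun z => (2 * hbar)^-1 *: bracket K z)
     (affine u w v) = affine u w (partial_exp D n v).
Proof.
rewrite /partial_exp; elim: n => [|n IH]; first by rewrite !big_ord0 affine0.
by rewrite !big_ord_recr /= IH iter_ad addrC -affine_lin addrC.
Qed.

(** By linear independence the partial sums in A determine their coordinates, so [ad_exp] amounts to
    convergence of row vectors. *)
Lemma ad_exp_affine v (l : 'rV[Cfield R]_(3 + 3 + 1)) :
  ad_exp hbar u w K (affine u w v) (affine u w l) <->
  ((fun n => partial_exp D n v : 'rV[Cfield R]_(3 + 3 + 1)) @ \oo --> l)%classic.
Proof.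
split=> [[s [l' [Hs lim El]]]|lim].
  rewrite (affine_inj El).
  suff -> : (fun n => partial_exp D n v) = s by [].
  by apply/funext=> n; apply: affine_inj; rewrite Hs affine_partial_exp.
exists (fun n => partial_exp D n v), l; split=> // n.
by rewrite affine_partial_exp.
Qed.
End Ad.

Lemma cvg_exp_to (D : 'M[C]_(3 + 3 + 1)) v (l : 'rV[Cfield R]_(3 + 3 + 1)) :
  ((fun n => partial_exp D n v : 'rV[Cfield R]_(3 + 3 + 1)) @ \oo --> l)%classic ->
  exp_to (F := Cfield R) D v l.
Proof.
move=> lim j.
have H := @coord_continuous (Cfield R) _ _ 0 j l.
exact: (cvg_comp _ _ lim H).
Qed.

Lemma cvg_square0 (D : 'M[C]_(3 + 3 + 1)) v : v *m D *m D = 0 ->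
  ((fun n => partial_exp D n v : 'rV[Cfield R]_(3 + 3 + 1)) @ \oo
    --> (v + v *m D : 'rV[Cfield R]_(3 + 3 + 1)))%classic.
Proof.
move=> DD; apply: cvg_near_cst.
by exists 2%N => // n /= n2; apply: partial_exp_square0.
Qed.

Lemma bracket_lin K x : bracket K (lin x) = \sum_j x 0 j *: bracket K (gen j).
Proof.
rewrite /lin mulr_suml mulr_sumr -sumrB; apply: eq_bigr => i _.
by rewrite -scalerAl -scalerAr -scalerBr.
Qed.

Lemma bracket_affine K v : bracket K (affine u w v) = bracket K (lin (lsubmx v)).
Proof.
by rewrite affineE mulrDl mulrDr opprD addrACA comm_scalar addr0.
Qed.

Lemma affine_row_mx x (c : 'rV[C]_1) : affine u w (row_mx x c) = lin x + (c 0 0)%:A.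
Proof. by rewrite affineE row_mxKl row_mxEr. Qed.

(** Bracketing with a linear form sends variables to constants and constants to 0; the exponential
    of this is a translation. *)
Definition linear_ad (l : 'rV[C]_(3 + 3)) : 'M[C]_(3 + 3 + 1) :=
  block_mx 0 (l *m OmegaC)^T 0 0.

Lemma linear_adP l v :
  (2 * hbar)^-1 *: bracket (lin l) (affine u w v) = affine u w (v *m linear_ad l).
Proof.
have h2 : 2 * hbar != 0 by rewrite mulf_neq0 ?pnatr_eq0.
rewrite -[v in RHS]hsubmxK mul_row_block !mulmx0 addr0 affine_row_mx addr0.
rewrite bracket_affine bracket_lin scaler_sumr mxE.
rewrite lin0 add0r scaler_suml; apply: eq_bigr => i _.
rewrite lin_comm !scalerA; congr (_ *: _).
rewrite [_^T i 0]mxE; field.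
by rewrite hbar_neq0.
Qed.

Lemma linear_ad_sqr l : linear_ad l *m linear_ad l = 0.
Proof. by rewrite mulmx_block !mulmx0 !mul0mx !addr0 block_mx0. Qed.

Definition quadratic (Q : 'M[C]_(3 + 3)) : A :=
  \sum_a \sum_b Q a b *: (gen a * gen b).
(** By the Leibniz rule Q enters through Q + Q^T; the transposition puts the image of the c-th
    variable in row c. *)
Definition quadratic_mx (Q : 'M[C]_(3 + 3)) : 'M[C]_(3 + 3) :=
  ((Q + Q^T) *m OmegaC)^T.
Definition quadratic_ad (N : 'M[C]_(3 + 3)) : 'M[C]_(3 + 3 + 1) :=
  block_mx N 0 0 0.

Lemma gen_mul_comm a b c : bracket (gen a * gen b) (gen c) =
  (2 * hbar) *: (OmegaC b c *: gen a + OmegaC a c *: gen b).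
Proof.
have -> : bracket (gen a * gen b) (gen c) =
    gen a * bracket (gen b) (gen c) + bracket (gen a) (gen c) * gen b.
  by rewrite mulrBr mulrBl !mulrA addrA subrK.
by rewrite !gen_comm mulr_algr mulr_algl scalerDr !scalerA.
Qed.

Lemma quadratic_comm Q c :
  bracket (quadratic Q) (gen c) = (2 * hbar) *: lin (row c (quadratic_mx Q)).
Proof.
have -> : bracket (quadratic Q) (gen c) = \sum_a \sum_b Q a b *:
    ((2 * hbar) *: (OmegaC b c *: gen a + OmegaC a c *: gen b)).
  rewrite /quadratic mulr_suml mulr_sumr -sumrB; apply: eq_bigr => a _.
  rewrite mulr_suml mulr_sumr -sumrB; apply: eq_bigr => b _.
  by rewrite -scalerAl -scalerAr -scalerBr gen_mul_comm.
rewrite /lin scaler_sumr.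
(* The names a and b are exchanged in the second half, to collect the coefficient of each
   [gen a]. *)
have -> : \sum_a \sum_b Q a b *:
    ((2 * hbar) *: (OmegaC b c *: gen a + OmegaC a c *: gen b)) =
    \sum_a (\sum_b (2 * hbar * (Q a b * OmegaC b c)) *: gen a)
    + \sum_a (\sum_b (2 * hbar * (Q b a * OmegaC b c)) *: gen a).
  rewrite [X in _ = _ + X]exchange_big -big_split; apply: eq_bigr => a _.
  rewrite -big_split; apply: eq_bigr => b _ /=.
  by rewrite !scalerDr !scalerA; congr (_ *: _ + _ *: _); ring.
rewrite -big_split; apply: eq_bigr => a _.
rewrite /= -!scaler_suml -scalerDl scalerA; congr (_ *: _).
rewrite -!mulr_sumr -mulrDr; congr (_ * _).
rewrite !mxE -big_split; apply: eq_bigr => b _ /=.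
by rewrite !mxE mulrDl.
Qed.

Lemma quadratic_adP Q v :
  (2 * hbar)^-1 *: bracket (quadratic Q) (affine u w v) =
  affine u w (v *m quadratic_ad (quadratic_mx Q)).
Proof.
have h2 : 2 * hbar != 0 by rewrite mulf_neq0 ?pnatr_eq0.
rewrite -[v in RHS]hsubmxK mul_row_block !mulmx0 !addr0 affine_row_mx mxE.
rewrite scale0r addr0.
rewrite bracket_affine bracket_lin mulmx_sum_row.
have -> : lin (\sum_i lsubmx v 0 i *: row i (quadratic_mx Q)) =
    \sum_i lsubmx v 0 i *: lin (row i (quadratic_mx Q)).
  by rewrite (big_morph lin linD lin0); apply: eq_bigr => i _; rewrite linZ.
rewrite scaler_sumr; apply: eq_bigr => i _.
rewrite quadratic_comm !scalerA; congr (_ *: _).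
field.
by rewrite hbar_neq0.
Qed.
End Adjoint.

Lemma ord3P (i : 'I_3) : [\/ i = jx 1, i = jx 2 | i = jx 3].
Proof.
by case: i => [[|[|[]]] ?] //; [constructor 1|constructor 2|constructor 3];
  apply: val_inj.
Qed.

(** * The matrix of the bracket with X *)

Section Quadratic.
Variables (R : realType) (alpha beta gamma : 'I_3 -> 'I_3 -> R[i]).
Local Notation C := R[i].

Definition upper (a : 'I_3 -> 'I_3 -> C) : 'M[C]_3 :=
  \matrix_(i, j) if (i < j)%N then a i j else 0.
Definition off_diagonal (a : 'I_3 -> 'I_3 -> C) : 'M[C]_3 :=
  \matrix_(i, j) if i != j then a i j else 0.
Definition coefficients : 'M[C]_(3 + 3) :=
  block_mx (upper alpha) (off_diagonal gamma) 0 (upper beta).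

Lemma quadraticXE (A : algType C) (u w : 'I_3 -> A) :
  quadraticX u w alpha beta gamma = quadratic u w coefficients.
Proof.
have E1 i : \sum_b coefficients (lshift 3 i) b *: (gen u w (lshift 3 i) * gen u w b) =
    \sum_(j < 3 | (i < j)%N) alpha i j *: (u i * u j)
    + \sum_(j < 3 | i != j) gamma i j *: (u i * w j).
  rewrite big_split_ord [in RHS]big_mkcond [X in _ = _ + X]big_mkcond; congr (_ + _).
    apply: eq_bigr => j _; rewrite block_mxEul mxE !gen_u /=.
    by case: ifP => _ //; rewrite scale0r.
  apply: eq_bigr => j _; rewrite block_mxEur mxE gen_u gen_w.
  by case: ifP => _ //; rewrite scale0r.
have E2 i : \sum_b coefficients (rshift 3 i) b *: (gen u w (rshift 3 i) * gen u w b) =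
    \sum_(j < 3 | (i < j)%N) beta i j *: (w i * w j).
  rewrite big_split_ord big1 => [|j _]; last by rewrite block_mxEdl mxE scale0r.
  rewrite [RHS]big_mkcond [LHS]add0r; apply: eq_bigr => j _.
  rewrite block_mxEdr mxE !gen_w /=.
  by case: ifP => _ //; rewrite scale0r.
rewrite /quadratic big_split_ord /= (eq_bigr _ (fun i _ => E1 i)).
rewrite (eq_bigr _ (fun i _ => E2 i)) /quadraticX big_split /= addrAC.
congr (_ + _); rewrite -big_split; apply: eq_bigr => i _ /=.
by rewrite big_split.
Qed.

Definition unknowns (k : nat) : C :=
  nth 0 [:: alpha (jx 1) (jx 2); alpha (jx 1) (jx 3); alpha (jx 2) (jx 3);
    beta (jx 1) (jx 2); beta (jx 1) (jx 3); beta (jx 2) (jx 3);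
    gamma (jx 1) (jx 2); gamma (jx 1) (jx 3); gamma (jx 2) (jx 1);
    gamma (jx 2) (jx 3); gamma (jx 3) (jx 1); gamma (jx 3) (jx 2)] k.

(** This links the bracket with X to the linear forms of the elimination; the 36 entries are
    compared one by one. *)
Lemma quadratic_mxE : quadratic_mx coefficients = ad_mx unknowns.
Proof.
have zN : zF C (Zneg xH) = -1 by [].
rewrite /quadratic_mx /coefficients tr_block_mx add_block_mx trmx0 addr0 add0r.
rewrite OmegaCE mulmx_block !mulmx0 !mulmx1 !mulmxN !add0r !addr0 !mulmx1 tr_block_mx.
apply/matrixP=> i j; rewrite [RHS]mxE entry_tabulate.
case: (fintype.split_ordP i) => a ->; case: (fintype.split_ordP j) => b ->;
  rewrite ?(block_mxEul, block_mxEur, block_mxEdl, block_mxEdr) !mxE;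
  have [->|->|->] := ord3P a; have [->|->|->] := ord3P b;
  rewrite /ad_form /unknown /unknowns /=
    ?(zF0, zF1, zN, mul0r, mul1r, mulN1r, add0r, addr0, oppr0) //.
Qed.
End Quadratic.

(** * Signed permutations *)

Section SignedPermutations.
Variable R : realType.
Local Notation C := R[i].
Local Notation V := 'rV[C]_(3 + 3 + 1).
Implicit Types (a b : 'I_3 -> V) (v : V) (s : 'S_3) (k : 'I_3 -> nat).

Lemma vsubst_lin a b c v v' :
  vsubst a b (c *: v + v') = c *: vsubst a b v + vsubst a b v'.
Proof.
rewrite /vsubst !mxE scalerDr addrACA; congr (_ + _); last first.
  by rewrite scalerDl scalerA; reflexivity.
rewrite scaler_sumr -big_split; apply: eq_bigr => i _.
rewrite !mxE !scalerDl scalerDr addrACA !scalerA; reflexivity.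
Qed.

Lemma pos_eqE i j :
  ((pos_u i == pos_u j) = (i == j)) * ((pos_w i == pos_w j) = (i == j)) *
  ((pos_u i == pos_w j) = false) * ((pos_w i == pos_u j) = false) *
  ((pos_c == pos_u j) = false) * ((pos_c == pos_w j) = false) *
  ((pos_u i == pos_c) = false) * ((pos_w i == pos_c) = false).
Proof.
rewrite -!val_eqE /= !eqn_add2l; have := ltn_ord i; have := ltn_ord j.
by do !split; apply/eqP; lia.
Qed.

Lemma vsubst_vu a b i : vsubst a b (vu R i) = a i.
Proof.
rewrite /vsubst !mxE (pos_eqE i i) (bigD1 i) //= big1 => [|j /negbTE ji].
  by rewrite !mxE !pos_eqE !eqxx scale1r !scale0r !addr0.
by rewrite !mxE !pos_eqE ji !scale0r addr0.
Qed.

Lemma vsubst_vw a b i : vsubst a b (vw R i) = b i.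
Proof.
rewrite /vsubst !mxE (pos_eqE i i) (bigD1 i) //= big1 => [|j /negbTE ji].
  by rewrite !mxE !pos_eqE !eqxx scale1r !scale0r !addr0 add0r.
by rewrite !mxE !pos_eqE ji !scale0r addr0.
Qed.

Lemma vsubst_vc a b : vsubst a b (vc R) = vc R.
Proof.
rewrite /vsubst !mxE !eqxx scale1r big1 ?add0r // => j _.
by rewrite !mxE !(pos_eqE j j) !scale0r addr0.
Qed.

Lemma row_basis v : v = vsubst (vu R) (vw R) v.
Proof.
rewrite [LHS]row_sum_delta big_split_ord big_split_ord /= -big_split big_ord1.
by [].
Qed.

Lemma vsubst_comp f a b v : (forall c x y, f (c *: x + y) = c *: f x + f y) ->
  f (vc R) = vc R ->
  f (vsubst a b v) = vsubst (fun i => f (a i)) (fun i => f (b i)) v.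
Proof.
move=> lin fc; have f0 : f 0 = 0.
  by have := lin (-1) 0 0; rewrite scaler0 addr0 scaleN1r addNr.
have fD x y : f (x + y) = f x + f y.
  by have := lin 1 x y; rewrite !scale1r.
have fZ c x : f (c *: x) = c *: f x by rewrite -[c *: x]addr0 lin f0 addr0.
rewrite /vsubst fD fZ fc (big_morph f fD f0); congr (_ + _).
by apply: eq_bigr => i _; rewrite fD !fZ.
Qed.

(** The image of u_i after m quarter turns u -> w -> -u -> -w; that of w_i is [turn m.+1 i]. *)
Definition turn (m : nat) (i : 'I_3) : V :=
  (-1) ^+ m./2 *: (if odd m then vw R i else vu R i).

(** A normal form for the elements of the group generated by permutations and turns. *)
Definition signed s k : V -> V :=
  vsubst (fun i => turn (k i) (s i)) (fun i => turn (k i).+1 (s i)).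

Lemma turn_double x q i : turn (x + q.*2) i = (-1) ^+ q *: turn x i.
Proof.
rewrite /turn oddD odd_double addbF halfD odd_double andbF add0n doubleK.
by rewrite scalerA -exprD [(q + _)%N]addnC.
Qed.

Lemma vsubstZ a b c v : vsubst a b (c *: v) = c *: vsubst a b v.
Proof.
have v0 : vsubst a b 0 = 0.
  by have := vsubst_lin a b (-1) 0 0; rewrite scaler0 addr0 scaleN1r addNr.
by rewrite -[c *: v]addr0 vsubst_lin v0 addr0.
Qed.

Lemma signed_turn s k m i : signed s k (turn m i) = turn (m + k i) (s i).
Proof.
have -> : (m + k i = odd m + k i + m./2.*2)%N by rewrite addnAC odd_double_half.
rewrite turn_double [in LHS]/turn /signed vsubstZ; congr (_ *: _).
by case: (odd m); rewrite (vsubst_vw, vsubst_vu).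
Qed.

Lemma signed_comp s k s' k' v : signed s k (signed s' k' v) =
  signed (s' * s)%g (fun i => k' i + k (s' i))%N v.
Proof.
rewrite {2}/signed vsubst_comp; last 2 first.
- exact: vsubst_lin.
- exact: vsubst_vc.
congr vsubst; apply/funext => i; rewrite signed_turn permM //.
Qed.

Lemma in_S3_signed rho : in_S3 rho -> exists s k, rho =1 signed s k.
Proof.
elim=> [s | i p | f g _ [s [k fE]] _ [s' [k' gE]]].
- exists s, (fun=> 0%N) => v; congr vsubst; apply/funext => i.
    by rewrite /turn scale1r.
  by rewrite /turn scale1r.
- move=> pE; have [t [t1 t2]] : exists t, p.1 = turn t i /\ p.2 = turn t.+1 i.
    (* The four listed pairs are 0, 1, 3 and 2 quarter turns. *)
    move: pE; rewrite !inE => /or4P[] /eqP ->;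
      [exists 0%N|exists 1%N|exists 3|exists 2];
      by rewrite /turn /= ?expr0 ?expr1 ?sqrrN ?expr1n ?scale1r ?scaleN1r.
  exists 1%g, (fun j => if j == i then t else 0%N) => v.
  rewrite /single_turn /signed; congr vsubst; apply/funext => j;
    by rewrite perm1; case: eqP => [->|_] //; rewrite /turn scale1r.
by exists (s' * s)%g, (fun i => k' i + k (s' i))%N => v; rewrite /= gE fE signed_comp.
Qed.

(** Repeated quarter turns at each of the three indices are followed by the permutation. *)
Lemma signed_in_S3 s k : exists2 rho, in_S3 rho & rho =1 signed s k.
Proof.
have one i t : exists2 rho, in_S3 rho &
    rho =1 signed 1%g (fun j => if j == i then t else 0%N).
  elim: t => [|t [rho Srho rhoE]].
    exists (single_turn i (vu R i, vw R i)).
      by apply: S3_turn; rewrite mem_head.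
    move=> v; congr vsubst; apply/funext => j; rewrite perm1;
      by case: eqP => [->|_]; rewrite /turn scale1r.
  exists (single_turn i (vw R i, - vu R i) \o rho).
    by apply: S3_comp => //; apply: S3_turn; rewrite !inE eqxx orbT.
  move=> v /=; rewrite rhoE.
  have -> x : single_turn i (vw R i, - vu R i) x =
      signed 1%g (fun j => if j == i then 1%N else 0%N) x.
    congr vsubst; apply/funext => j; rewrite perm1;
      by case: eqP => [->|_]; rewrite /turn ?expr1 ?scale1r ?scaleN1r.
  rewrite signed_comp mulg1; congr signed; apply/funext => j.
  by rewrite perm1; case: eqP => // _; rewrite addn1.
have [r1 S1 E1] := one (jx 1) (k (jx 1)).
have [r2 S2 E2] := one (jx 2) (k (jx 2)).
have [r3 S3 E3] := one (jx 3) (k (jx 3)).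
exists (vsubst (fun i => vu R (s i)) (fun i => vw R (s i)) \o (r1 \o (r2 \o r3))).
  by apply: S3_comp; [exact: S3_perm | do 2?[apply: S3_comp => //]].
move=> v /=; rewrite E3 E2 E1 !signed_comp.
have -> x : vsubst (fun i => vu R (s i)) (fun i => vw R (s i)) x =
    signed s (fun=> 0%N) x.
  by congr vsubst; apply/funext => j; rewrite /turn scale1r.
rewrite signed_comp !mulg1 mul1g; congr signed; apply/funext => j.
by rewrite !perm1; have [->|->|->] := ord3P j; rewrite /= ?addn0.
Qed.

Lemma turn_row m i : turn m i =
  row_mx (\row_j if j == (i + 3 * odd m)%N :> nat then (-1) ^+ m./2 else 0) 0.
Proof.
apply/rowP=> j; rewrite /turn !mxE.
have -> : (if odd m then vw R i else vu R i) 0 j =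
    (j == (i + 3 * odd m)%N :> nat)%:R.
  case: (odd m); rewrite !mxE eqxx -val_eqE /= ?muln1 ?muln0 ?addn0 //.
  by rewrite [(3 + i)%N]addnC.
case: (fintype.split_ordP j) => l ->.
  by rewrite mxE /=; case: eqP; rewrite ?mulr1 ?mulr0.
rewrite mxE /= eqn_leq leqNgt [X in ~~ X](_ : _ = true) ?mulr0 //.
by have := ltn_ord i; case: (odd m); lia.
Qed.

(** Four quarter turns are the identity, so the k_i are reduced modulo 4. *)
Lemma signed_row s k v :
  let P := turn_table
    [:: nat_of_ord (s (jx 1)); nat_of_ord (s (jx 2)); nat_of_ord (s (jx 3))]
    [:: k (jx 1) %% 4; k (jx 2) %% 4; k (jx 3) %% 4]%N in
  signed s k v = row_mx (lsubmx v *m zmx C P) (rsubmx v).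
Proof.
move=> P; pose prow i := row_mx (row i (zmx C P)) (0 : 'rV[C]_1).
(* e = 0 treats the row of u_i, and e = 1 that of w_i, which has index i + 3 and one more turn. *)
have turnE i (i' : 'I_6) e m : (e < 2)%N -> m = (k i + e)%N ->
    i' = (i + 3 * e)%N :> nat -> turn m (s i) = prow i'.
  move=> e2 -> iE; rewrite turn_row; congr row_mx; apply/rowP=> j.
  have i3 := ltn_ord i.
  rewrite !mxE entry_tabulate iE.
  have -> : ((i + 3 * e) %/ 3 = e)%N by lia.
  have -> : ((i + 3 * e) %% 3 = i)%N by lia.
  cbv zeta.
  have -> : nth 0%N
      [:: nat_of_ord (s (jx 1)); nat_of_ord (s (jx 2)); nat_of_ord (s (jx 3))] i = s i.
    by have [->|->|->] := ord3P i.
  have -> : nth 0%N [:: k (jx 1) %% 4; k (jx 2) %% 4; k (jx 3) %% 4]%N i =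
      (k i %% 4)%N.
    by have [->|->|->] := ord3P i.
  rewrite modnDml; move: (k i + e)%N => m'.
  have -> : odd (m' %% 4) = odd m' by lia.
  case: eqP => // _; rewrite -signr_odd.
  have -> : odd m'./2 = (1 < m' %% 4)%N by lia.
  by case: ltnP.
rewrite /signed /vsubst -[lsubmx v *m _]addr0 -[rsubmx v]add0r -add_row_mx.
congr (_ + _); last first.
  apply/rowP=> j; case: (fintype.split_ordP j) => l ->;
    rewrite (row_mxEl, row_mxEr) !mxE.
    by rewrite eq_lrshift mulr0.
  by rewrite (ord1 l) eqxx mulr1.
have -> : row_mx (lsubmx v *m zmx C P) 0 = \sum_i lsubmx v 0 i *: prow i.
  rewrite mulmx_sum_row; apply/rowP=> j; rewrite summxE.
  case: (fintype.split_ordP j) => l ->; rewrite ?row_mxEl ?row_mxEr ?summxE ?mxE.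
    by apply: eq_bigr => i _; rewrite [in RHS]mxE row_mxEl mxE.
  by rewrite big1 // => i _; rewrite mxE row_mxEr [(0 : 'rV_1) _ _]mxE mulr0.
rewrite big_split_ord /= -big_split; apply: eq_bigr => i _ /=.
rewrite !mxE; congr (_ *: _ + _ *: _).
  by apply: (turnE i _ 0%N); rewrite ?addn0.
by apply: (turnE i _ 1%N); rewrite ?addn1 //= muln1 addnC.
Qed.
End SignedPermutations.

(** * Realizations as matrix equations *)

Section Tables.
Variable R : realType.
Local Notation C := R[i].
Local Notation V := 'rV[C]_(3 + 3 + 1).

Definition acts_by (rho : V -> V) (P : table Z) : Prop :=
  forall v, rho v = row_mx (lsubmx v *m zmx C P) (rsubmx v).

Lemma in_S3_table (rho : V -> V) : in_S3 rho ->
  exists pi k, [/\ pi \in perms3, k \in turns & acts_by rho (turn_table pi k)].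
Proof.
move=> /in_S3_signed[s [k rhoE]].
exists [:: nat_of_ord (s (jx 1)); nat_of_ord (s (jx 2)); nat_of_ord (s (jx 3))].
exists [:: k (jx 1) %% 4; k (jx 2) %% 4; k (jx 3) %% 4]%N; split.
- have n12 : s (jx 1) != s (jx 2) by rewrite (inj_eq perm_inj).
  have n13 : s (jx 1) != s (jx 3) by rewrite (inj_eq perm_inj).
  have n23 : s (jx 2) != s (jx 3) by rewrite (inj_eq perm_inj).
  move: n12 n13 n23.
  by have [->|->|->] := ord3P (s (jx 1)); have [->|->|->] := ord3P (s (jx 2));
     have [->|->|->] := ord3P (s (jx 3)).
- by apply/allpairsP; exists (k (jx 1) %% 4, [:: k (jx 2) %% 4; k (jx 3) %% 4])%N;
     split => //; [rewrite mem_iota ltn_mod | apply/allpairsP;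
     exists (k (jx 2) %% 4, k (jx 3) %% 4)%N; rewrite !mem_iota !ltn_mod].
by move=> v; rewrite rhoE; exact: signed_row.
Qed.

Lemma table_in_S3 pi k : pi \in perms3 -> k \in turns ->
  exists2 rho : V -> V, in_S3 rho & acts_by rho (turn_table pi k).
Proof.
move=> pi3 kt.
have [s sE] : exists s : 'S_3, forall i, nat_of_ord (s i) = nth 0%N pi i.
  have inj : injective (fun i : 'I_3 => inord (nth 0%N pi i) : 'I_3).
    move=> i j /(congr1 val) /=.
    have lt3 (l : 'I_3) : (nth 0%N pi l < 3)%N.
      by move: pi3; rewrite !inE => /or4P[|||/or3P[]] /eqP ->;
        have [->|->|->] := ord3P l.
    rewrite !inordK // => e; move: pi3 e.
    by rewrite !inE => /or4P[|||/or3P[]] /eqP ->;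
      have [->|->|->] := ord3P i; have [->|->|->] := ord3P j.
  exists (perm inj) => i; rewrite permE inordK //.
  by move: pi3; rewrite !inE => /or4P[|||/or3P[]] /eqP ->;
    have [->|->|->] := ord3P i.
have [rho Srho rhoE] := signed_in_S3 R s (fun i => nth 0%N k i).
(* Checked by evaluation on each of the six lists. *)
have piE : [:: nat_of_ord (s (jx 1)); nat_of_ord (s (jx 2)); nat_of_ord (s (jx 3))] = pi.
  by rewrite !sE; apply/eqP; move: pi pi3 {sE}; apply/allP.
have kE : [:: nth 0 k (jx 1) %% 4; nth 0 k (jx 2) %% 4; nth 0 k (jx 3) %% 4]%N = k.
  by apply/eqP; move: k kt {rhoE}; apply/allP.
by exists rho => // v; rewrite rhoE signed_row piE kE.
Qed.
End Tables.

Section Realization.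
Variables (R : realType) (hbar : R[i]) (A : algType R[i]) (u w : 'I_3 -> A).
Variables (lambda : 'I_3 -> R[i]) (T : uwmap).
Local Notation C := R[i].
Local Notation V := 'rV[C]_(3 + 3 + 1).
Hypothesis hbar_neq0 : hbar != 0.
Hypothesis ccr : canonical_commutation hbar u w.

Definition intr_row (l : linform) : 'rV[C]_(3 + 3) := map_mx intr (form_row l).

Lemma eval_formE l :
  eval_form lambda l = row_mx (intr_row l) (lambda_part lambda l)%:M.
Proof.
rewrite [RHS]row_basis /vsubst /eval_form; congr (_ + _); last first.
  by rewrite row_mxEr mxE eqxx mulr1n.
apply: eq_bigr => i _; rewrite !row_mxEl.
by congr (_ *: _ + _ *: _); rewrite [RHS]mxE (row_mxEl, row_mxEr).
Qed.

Lemma lin_delta i : lin u w (delta_mx 0 i) = gen u w i.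
Proof.
rewrite /lin (bigD1 i) //= big1 => [|j ji]; rewrite mxE !eqxx ?scale1r ?addr0 //.
by rewrite (negbTE ji) scale0r.
Qed.

Lemma gen_affine i : gen u w i = affine u w (row_mx (delta_mx 0 i) 0).
Proof. by rewrite affine_row_mx mxE scale0r addr0 lin_delta. Qed.

Lemma linearLE delta delta' : linearL u w delta delta' =
  lin u w (row_mx (\row_i delta i) (\row_i delta' i)).
Proof.
rewrite /lin big_split_ord /= -big_split; apply: eq_bigr => i _ /=.
by rewrite row_mxEl row_mxEr !mxE gen_u gen_w.
Qed.

Lemma adjoint_realizableE : adjoint_realizable hbar lambda u w T <->
  exists (alpha beta gamma : 'I_3 -> 'I_3 -> C) (delta delta' : 'I_3 -> C)
         (rho : V -> V), in_S3 rho /\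
    forall i, Ad_maps hbar u w (quadraticX u w alpha beta gamma) rho
      (linearL u w delta delta') (gen u w i)
      (affine u w (eval_form lambda (gen_image T i))).
Proof.
split=> -[a [b [c [d [d' [rho [Srho H]]]]]]]; exists a, b, c, d, d', rho;
  split=> // i.
  rewrite /gen /gen_image; case: fintype.split => j; first by have [] := H j.
  by have [] := H j.
split; [have := H (lshift 3 i) | have := H (rshift 3 i)];
  rewrite ?gen_u ?gen_w /gen_image.
  by rewrite -[lshift 3 i]/(unsplit (inl i)) unsplitK.
by rewrite -[rshift 3 i]/(unsplit (inr i)) unsplitK.
Qed.

(** The matrix is N on linear parts and 0 on constants, so linear parts evolve on their own. *)
Lemma lsubmx_partial_exp (N : 'M[C]_(3 + 3)) n (v : V) :
  lsubmx (partial_exp (quadratic_ad N) n v) = partial_exp N n (lsubmx v).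
Proof.
rewrite /partial_exp linear_sum; apply: eq_bigr => k _; rewrite linearZ /=.
congr (_ *: _); elim: (nat_of_ord k) => //= m <-.
rewrite /act -[iter m _ v in LHS]hsubmxK mul_row_block !mulmx0 !addr0.
by rewrite row_mxKl.
Qed.

Lemma mul_linear_ad l x c :
  row_mx x c *m linear_ad l = row_mx 0 (x *m (l *m OmegaC R)^T) :> V.
Proof. by rewrite mul_row_block !mulmx0 !addr0. Qed.

(** L alters only the constants and rho acts on linear parts by P; what remains is P exp(N) = M, row
    by row. *)
Lemma realizable_exp_to : adjoint_realizable hbar lambda u w T ->
  exists pi k x, [/\ pi \in perms3, k \in turns &
    forall i, exp_to (F := Cfield R) (ad_mx x)
      (row i (zmx (Cfield R) (turn_table pi k))) (intr_row (gen_image T i))].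
Proof.
move=> /adjoint_realizableE[a [b [c [d [d' [rho [Srho H]]]]]]].
have [pi [k [pi3 kt rhoE]]] := in_S3_table Srho.
exists pi, k, (unknowns a b c); split=> // i.
have [v []] := H i.
rewrite gen_affine linearLE; set l := row_mx _ _.
move/(ad_exp_affine hbar_neq0 ccr (linear_adP hbar_neq0 ccr l))/cvg_exp_to.
(* The series of L stops after its linear term, which determines the intermediate vector v. *)
move/exp_to_unique => /(_ _ (exp_to_square0 _)) ->; last first.
  by rewrite -mulmxA linear_ad_sqr mulmx0.
rewrite mul_linear_ad add_row_mx addr0 add0r rhoE row_mxKl row_mxKr -rowE.
rewrite quadraticXE eval_formE.
move/(ad_exp_affine hbar_neq0 ccr (quadratic_adP hbar_neq0 ccr _))/cvg_exp_to.
rewrite quadratic_mxE => lim j; have := lim (lshift 1 j); rewrite row_mxEl.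
suff -> : (fun n => partial_exp (ad_mx (unknowns a b c)) n
      (row i (zmx (Cfield R) (turn_table pi k))) 0 j) =
    (fun n => partial_exp (quadratic_ad (ad_mx (unknowns a b c))) n
      (row_mx (row i (zmx C (turn_table pi k)))
         ('e_i *m (l *m OmegaC R)^T)) 0 (lshift 1 j)) by [].
apply/funext => n.
have := lsubmx_partial_exp (ad_mx (unknowns a b c)) n
  (row_mx (row i (zmx C (turn_table pi k))) ('e_i *m (l *m OmegaC R)^T)).
by rewrite row_mxKl => /rowP/(_ j); rewrite mxE => E; exact: esym E.
Qed.

(** When N^2 = 0, exp(N) = 1 + N. L is chosen to create the lambda constants, which rho and X leave
    unchanged. *)
Lemma exp_realizable pi k x : pi \in perms3 -> k \in turns ->
  ad_mx (unknowns x.1.1 x.1.2 x.2) *m ad_mx (unknowns x.1.1 x.1.2 x.2) = 0 ->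
  (forall i, let r := row i (zmx C (turn_table pi k)) in
     r + r *m ad_mx (unknowns x.1.1 x.1.2 x.2) = intr_row (gen_image T i)) ->
  adjoint_realizable hbar lambda u w T.
Proof.
case: x => [[a b] c] pi3 kt sqr0 H; apply/adjoint_realizableE.
have [rho Srho rhoE] := table_in_S3 R pi3 kt.
pose t : 'rV[C]_(3 + 3) := \row_i lambda_part lambda (gen_image T i).
(* Since Omega^2 = -1, l Omega = t is the row of the required constants. *)
pose l := - (t *m OmegaC R).
exists a, b, c, (fun i => l 0 (lshift 3 i)), (fun i => l 0 (rshift 3 i)), rho.
split=> // i; set y := eval_form _ _.
pose c_i : 'M[C]_1 := (lambda_part lambda (gen_image T i))%:M.
exists (row_mx (delta_mx 0 i) c_i); split.
  have lE : row_mx (\row_i l 0 (lshift 3 i)) (\row_i l 0 (rshift 3 i)) = l.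
    apply/rowP=> j; case: (fintype.split_ordP j) => m ->;
    by rewrite (row_mxEl, row_mxEr) mxE.
  rewrite linearLE lE gen_affine.
  apply/(ad_exp_affine hbar_neq0 ccr (linear_adP hbar_neq0 ccr l)).
  have -> : row_mx (delta_mx 0 i) c_i =
      row_mx (delta_mx 0 i) 0 + row_mx (delta_mx 0 i) 0 *m linear_ad l.
    rewrite mul_linear_ad add_row_mx addr0 add0r; congr row_mx.
    rewrite mulNmx -mulmxA OmegaC_sqr mulmxN mulmx1 opprK.
    by rewrite -rowE; apply/rowP=> j; rewrite !mxE (ord1 j) eqxx mulr1n.
  by apply: cvg_square0; rewrite -mulmxA linear_ad_sqr mulmx0.
rewrite quadraticXE rhoE row_mxKl row_mxKr -rowE.
apply/(ad_exp_affine hbar_neq0 ccr (quadratic_adP hbar_neq0 ccr _)).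
rewrite quadratic_mxE.
set r := row_mx _ _; set D := quadratic_ad _.
have -> : y = r + r *m D.
  rewrite /r /D mul_row_block !mulmx0 !addr0 add_row_mx addr0.
  by rewrite /y eval_formE -H.
apply: cvg_square0; rewrite -mulmxA /D mulmx_block !mulmx0 !mul0mx !addr0.
by rewrite sqr0 block_mx0 mulmx0.
Qed.
End Realization.

(** * The sixteen sign choices *)

Definition uw_ztable (e : bool * bool * bool * bool) : table Z :=
  let: (e1, e2, e3, e4) := e in map zvec (uw_table e1 e2 e3 e4).

Lemma zmx_zvec (F : numFieldType) (t : table int) :
  zmx F (map zvec t) = map_mx intr (imx 6 6 t).
Proof.
have nth_zvec s j : nth Z0 (zvec s) j = Z_of_int (nth 0 s j).
  case: (ltnP j (size s)) => sj; first by rewrite (nth_map 0).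
  by rewrite !nth_default // size_map.
apply/matrixP=> i j; rewrite !mxE /entry /zF.
have -> : nth [::] (map zvec t) i = zvec (nth [::] t i).
  case: (ltnP i (size t)) => st; first by rewrite (nth_map [::]).
  by rewrite !nth_default // size_map.
by rewrite nth_zvec Z_of_intK.
Qed.

Fixpoint zeval (r : form) (xs : seq Z) : Z :=
  if r is c :: r' then Z.add (Z.mul c (nth Z0 xs 0)) (zeval r' (behead xs))
  else Z0.
Definition ad_ztable (xs : seq Z) := tabulate 6 6 (fun i j => zeval (ad_form i j) xs).

Lemma zmx_ad_ztable (F : numFieldType) xs :
  zmx F (ad_ztable xs) = ad_mx (fun k => zF F (nth Z0 xs k)).
Proof.
apply/matrixP=> i j; rewrite !mxE !entry_tabulate.
elim: (ad_form i j) xs => //= c r IH xs; rewrite zFD zFM IH; congr (_ + feval _ _).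
by apply/funext=> k; rewrite nth_behead.
Qed.

(** A certificate for M = P exp(N): the conditions N^2 = 0 and M = P + P N. *)
Definition is_exp (M : table Z) (d : seq nat * seq nat * seq Z) : bool :=
  let: (pi, k, xs) := d in
  let P := turn_table pi k in let N := ad_ztable xs in let PN := zmul P N in
  [&& pi \in perms3, k \in turns, size xs == 12,
      zeq (zmul N N) (tabulate 6 6 (fun _ _ => Z0))
    & zeq (tabulate 6 6 (fun i j => Z.add (entry Z0 P i j) (entry Z0 PN i j))) M].

Definition good_signs : seq (bool * bool * bool * bool) :=
  [:: (false, false, false, false); (false, false, true, true);
      (false, true, false, true); (true, false, true, false);
      (true, true, false, false); (true, true, true, true)].

(** Certificates with N = P^-1 M - 1; each good sign choice is matched by at least one of them. *)
Definition exponents : seq (seq nat * seq nat * seq Z) :=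
  [:: ([:: 1; 2; 0]%N, [:: 0; 0; 1]%N,
       zvec [:: 0; 0; 0; 0; 1; 0; 0; 0; 1; -1; 0; 0]);
      ([:: 0; 2; 1]%N, [:: 0; 0; 0]%N,
       zvec [:: 0; 0; 0; -1; 1; 0; 1; -1; 0; 0; 0; 0]);
      ([:: 2; 1; 0]%N, [:: 3; 0; 1]%N,
       zvec [:: 0; 0; -1; 1; 0; 0; 0; 0; 1; 0; 0; -1]);
      ([:: 1; 0; 2]%N, [:: 0; 0; 0]%N,
       zvec [:: 0; -1; 1; 0; 0; 0; 0; 1; 0; -1; 0; 0]);
      ([:: 2; 1; 0]%N, [:: 3; 0; 1]%N,
       zvec [:: 0; 0; -1; 1; 0; 0; 0; 0; 1; 0; 0; -1]);
      ([:: 2; 0; 1]%N, [:: 3; 0; 0]%N,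
       zvec [:: 0; -1; 0; 0; 0; 0; 1; 0; 0; 0; 0; -1])].

Lemma good_is_exp e : e \in good_signs -> has (is_exp (uw_ztable e)) exponents.
Proof. by move: e; apply/allP; lazy. Qed.

Lemma good_realizable (R : realType) (hbar : R[i]) lambda (A : algType R[i])
    (u w : 'I_3 -> A) e T :
  hbar != 0 -> canonical_commutation hbar u w ->
  (forall i, intr_row R (gen_image T i) = row i (zmx R[i] (uw_ztable e))) ->
  e \in good_signs -> adjoint_realizable hbar lambda u w T.
Proof.
move=> hbar0 ccr TE /good_is_exp/hasP[[[pi k] xs] _].
case/and5P=> pi3 kt /eqP size_xs /zmx_eq sqr0 /zmx_eq PN.
(* The index functions of [ad_form] read the coefficients of X back from the certificate. *)
pose alpha (i j : 'I_3) : R[i] := zF _ (nth Z0 xs (sym_index i j)).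
pose beta (i j : 'I_3) : R[i] := zF _ (nth Z0 xs (3 + sym_index i j)).
pose gamma (i j : 'I_3) : R[i] := zF _ (nth Z0 xs (gamma_index i j)).
have xE : ad_mx (unknowns alpha beta gamma) = zmx R[i] (ad_ztable xs).
  rewrite zmx_ad_ztable; congr ad_mx; apply/funext=> n.
  rewrite /unknowns /alpha /beta /gamma /=.
  (* Beyond the twelve unknowns both sides take the default value 0. *)
  do 12![case: n => [//|n]].
  by rewrite [in RHS]nth_default ?size_xs //= nth_nil.
apply: (exp_realizable lambda hbar0 ccr (x := (alpha, beta, gamma)) pi3 kt) => /=.
  rewrite xE -zmx_mul sqr0; apply/matrixP=> i j.
  by rewrite !mxE entry_tabulate.
move=> i; rewrite xE -row_mul -zmx_mul TE -PN; apply/rowP=> j.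
by rewrite !mxE entry_tabulate zFD.
Qed.

Definition all_signs : seq (bool * bool * bool * bool) :=
  [seq (e, e4) | e <- [seq (e, e3) | e <- [seq (e1, e2) | e1 <- [:: true; false],
    e2 <- [:: true; false]], e3 <- [:: true; false]], e4 <- [:: true; false]].
Definition bad_signs := [seq e <- all_signs | e \notin good_signs].

(** Ten sign choices times 384 matrices P; the kernel evaluates the boolean at [Qed]. *)
Lemma bad_never_exp :
  never_exp candidates refinements refined_candidates uw_ztable bad_signs.
Proof. exact_no_check (erefl true). Qed.

Theorem proposition4p4 (R : realType) (hbar : R[i])
    (q_generic : forall n : nat, (0 < n)%N -> cexp hbar ^+ n != 1)
    (lambda : 'I_3 -> R[i])
    (A : algType R[i]) (u w : 'I_3 -> A)
    (uw_canonical : canonical_commutation hbar u w)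
    (e1 e2 e3 e4 : bool) (T : uwmap)
    (T_induced : is_tau_uw hbar lambda e1 e2 e3 e4 T) :
  adjoint_realizable hbar lambda u w T <->
  (e1, e2, e3, e4) \in
    [:: (false, false, false, false); (false, false, true, true);
        (false, true, false, true); (true, false, true, false);
        (true, true, false, false); (true, true, true, true)].
Proof.
(* For hbar = 0 one would have q = 1, against genericity at n = 1. *)
have hbar0 : hbar != 0.
  by apply: contraTneq (q_generic 1%N isT) => ->; rewrite cexp0 eqxx.
rewrite -/good_signs; set e := (e1, e2, e3, e4).
have TE i : intr_row R (gen_image T i) = row i (zmx R[i] (uw_ztable e)).
  rewrite /intr_row (tau_uw_table T_induced) zmx_zvec.
  by apply/rowP=> j; rewrite !mxE.
split=> [real|]; last exact: good_realizable.
apply: contraT => bad.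
have {}bad : e \in bad_signs.
  rewrite mem_filter bad.
  by move: e1 e2 e3 e4 @e {bad TE T_induced} => [] [] [] [].
have [pi [k [x [pi3 kt H]]]] := realizable_exp_to hbar0 uw_canonical real.
case: (exp_to_never_exp (F := Cfield R) (x := x) bad_never_exp bad pi3 kt) => j.
by rewrite -[row j (zmx _ (uw_ztable e))]TE.
Qed.
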